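(* Consider the closed-loop system $$\dot{x}(t)=f(t,x_t,k(x(t)+\epsilon(t))),\qquad x_{t_0}=\varphi,$$ where $\epsilon(t)=x(t_i)-x(t)$ for $t\in[t_i,t_{i+1})$, i.e. the system $\dot x(t)=f(t,x_t,u(t))$ with sampled feedback $u(t)=k(x(t_i))$ on $[t_i,t_{i+1})$, with $f$, $k$, $\varphi$ as in the context. Suppose there exist functions $V_1\in\mathcal{V}_0$, $V_2\in\mathcal{V}_0^*$, $\alpha_1,\alpha_2,\alpha_3\in\mathcal{K}_\infty$, $\chi\in\mathcal{K}$ and a constant $\mu>0$ such that, for all $t\in\mathbb{R}^+$ and $\phi\in\mathcal{C}([-\tau,0],\mathbb{R}^n)$: (i) $\alpha_1(\|\phi(0)\|)\le V_1(t,\phi(0))\le\alpha_2(\|\phi(0)\|)$ and $0\le V_2(t,\phi)\le\alpha_3(\|\phi\|_\tau)$; (ii) $V(t,\phi):=V_1(t,\phi(0))+V_2(t,\phi)$ satisfies, along the closed-loop system, $\mathrm{D}^+V(t,\phi)\le-\mu V(t,\phi)+\chi(\|\epsilon\|)$. Let the event times be defined, starting from the initial time $t_0$, by $$t_{i+1}=\inf\left\{t\ge t_i \;\middle|\; \chi(\|\epsilon(t)\|)=\sigma\,\alpha_1(\|x(t)\|)+\chi\left(a e^{-b(t-t_0)}\right)\right\},$$ with constants $0\le\sigma<\mu$, $a>0$ and $b>0$. Assume further that (iii) $\chi$ and $k$ are locally Lipschitz, and $\alpha_1^{-1}$ (the inverse of $\alpha_1$) is Lipschitz on any closed and bounded sub-interval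 of $(0,\infty)$; (iv) $f$ is locally Lipschitz in its second and third arguments, respectively. Then the closed-loop system with these event times is globally asymptotically stable and does not exhibit Zeno behavior.
   Context: Notation: $\mathbb{R}^+=[0,\infty)$; $\|\cdot\|$ is the Euclidean norm; $\tau>0$ is the maximum delay; $\mathcal{C}(J,\mathbb{R}^n)$ is the set of continuous functions from an interval $J$ to $\mathbb{R}^n$; $\mathcal{C}([-\tau,0],\mathbb{R}^n)$ carries the norm $\|\phi\|_\tau=\sup_{s\in[-\tau,0]}\|\phi(s)\|$; $x_t(s):=x(t+s)$ for $s\in[-\tau,0]$. System data: $x(t)\in\mathbb{R}^n$, $u(t)\in\mathbb{R}^m$; $t_0$ is the initial time and $\varphi\in\mathcal{C}([-\tau,0],\mathbb{R}^n)$ the initial function; $f:\mathbb{R}^+\times\mathcal{C}([-\tau,0],\mathbb{R}^n)\times\mathbb{R}^m\to\mathbb{R}^n$ satisfies $f(t,0,0)=0$ for all $t\in\mathbb{R}^+$; the feedback law $k:\mathbb{R}^n\to\mathbb{R}^m$ satisfies $k(0)=0$. Function classes: $\alpha\in\mathcal{K}$ if $\alpha$ on $\mathbb{R}^+$ is continuous, strictly increasing, and $\alpha(0)=0$; $\alpha\in\mathcal{K}_\infty$ if in addition $\alpha(s)\to\infty$ as $s\to\infty$. $V_1:\mathbb{R}^+\times\mathbb{R}^n\to\mathbb{R}^+$ is in $\mathcal{V}_0$ if for each $x\in\mathcal{C}(\mathbb{R}^+,\mathbb{R}^n)$ the map $t\mapsto V_1(t,x(t))$ is continuous. $V_2:\mathbb{R}^+\times\mathcal{C}([-\tau,0],\mathbb{R}^n)\to\mathbb{R}^+$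 is in $\mathcal{V}_0^*$ if for each $x\in\mathcal{C}([-\tau,\infty),\mathbb{R}^n)$ the map $t\mapsto V_2(t,x_t)$ is continuous for all $t\ge0$, and $V_2$ is locally Lipschitz in its second argument. Dini derivative along the system: $\mathrm{D}^+V(t,\phi)=\limsup_{h\to0^+}\frac{V(t+h,x_{t+h}(t,\phi))-V(t,\phi)}{h}$, where $x(t,\phi)$ denotes the solution of the system satisfying $x_t=\phi$. Stability notions: the system is globally asymptotically stable if its zero solution is stable (for every $\varepsilon>0$ there is $\delta>0$ such that $\|\varphi\|_\tau<\delta$ implies $\|x(t)\|<\varepsilon$ for all $t\ge t_0$) and globally attractive ($\lim_{t\to\infty}\|x(t)\|=0$ for every initial function $\varphi\in\mathcal{C}([-\tau,0],\mathbb{R}^n)$). Zeno behavior means that infinitely many event times $t_i$ occur over a finite time interval.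
   Formalization: ''f locally Lipschitz'' is taken as Lipschitz on bounded sets, uniformly for t in bounded intervals (with t-dependent constants Zeno behavior can occur), and local existence of the solution x(t,φ) with held feedback, presupposed by the Dini derivative, is an explicit hypothesis. *)

(* Defs.v *)
From mathcomp Require Export all_boot all_order all_algebra.
From mathcomp Require Export all_classical all_reals all_analysis.
Export Order.TTheory GRing.Theory Num.Theory numFieldNormedType.Exports.

Set Implicit Arguments.
Unset Strict Implicit.
Unset Printing Implicit Defensive.

Local Open Scope classical_set_scope.
Local Open Scope ring_scope.

(* The norm that the library puts on ['rV[R]_n] is the maximum norm; it has the
   same topology and the same Lipschitz functions as this one. *)
Definition enorm (R : realType) (n : nat) (x : 'rV[R]_n) : R :=
  Num.sqrt (\sum_(i < n) x 0 i ^+ 2).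

(* Histories are functions on the subtype [-tau, 0]. Functionals are total on
   [history tau n]; every hypothesis on them is restricted to the continuous
   histories, which form C([-tau, 0], R^n). *)
Notation delay_interval tau := (set_type `[- tau%:num, 0]%classic).

Definition history (R : realType) (tau : {posnum R}) (n : nat) : Type :=
  delay_interval tau -> 'rV[R]_n.

Lemma zero_in_delay_interval (R : realType) (tau : {posnum R}) :
  (0 : R) \in `[- tau%:num, 0 : R]%classic.
Proof. by rewrite mem_setE in_itv /= oppr_le0 lexx andbT. Qed.

Definition now (R : realType) (tau : {posnum R}) : delay_interval tau :=
  exist _ 0 (zero_in_delay_interval tau).

Definition hist (R : realType) (tau : {posnum R}) (n : nat)
    (x : R -> 'rV[R]_n) (t : R) : history tau n :=
  fun s => x (t + set_val s).

Arguments hist {R} tau {n} x t s.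

Definition hnorm (R : realType) (tau : {posnum R}) (n : nat)
    (phi : history tau n) : R :=
  sup (range (fun s => enorm (phi s))).

Section FunctionClasses.
Context (R : realType) (tau : {posnum R}) (n : nat).

Definition classK (alpha : R -> R) : Prop :=
  [/\ {within `[0, +oo[, continuous alpha},
      {in `[0, +oo[ &, {homo alpha : s r / s < r}} &
      alpha 0 = 0].

Definition classKinf (alpha : R -> R) : Prop :=
  classK alpha /\ alpha s @[s --> +oo] --> +oo.

Definition classV0 (V1 : R -> 'rV[R]_n -> R) : Prop :=
  (forall (t : R) y, 0 <= t -> 0 <= V1 t y) /\
  (forall x : R -> 'rV[R]_n, {within `[0, +oo[, continuous x} ->
     {within `[0, +oo[, continuous (fun t => V1 t (x t))}).

Definition classV0star (V2 : R -> history tau n -> R) : Prop :=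
  [/\ forall (t : R) (phi : history tau n),
        0 <= t -> continuous phi -> 0 <= V2 t phi,
      forall x : R -> 'rV[R]_n, {within `[- tau%:num, +oo[, continuous x} ->
        {within `[0, +oo[, continuous (fun t => V2 t (hist tau x t))} &
      forall (t : R) (phi : history tau n), 0 <= t -> continuous phi ->
        exists r L : R, 0 < r /\
          forall psi1 psi2 : history tau n,
            continuous psi1 -> continuous psi2 ->
            hnorm (psi1 \- phi) <= r -> hnorm (psi2 \- phi) <= r ->
            `|V2 t psi1 - V2 t psi2| <= L * hnorm (psi1 \- psi2)].

(* Local Lipschitz continuity of a functional on the infinite-dimensional space
   C([-tau, 0], R^n) is understood on bounded sets, with constants that are
   uniform for time in bounded intervals. *)
Definition locally_lipschitz2 (m : nat)
    (f : R -> history tau n -> 'rV[R]_m -> 'rV[R]_n) : Prop :=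
  forall r : R, exists L : R,
    forall (t : R) (phi psi : history tau n) (u : 'rV[R]_m), 0 <= t <= r ->
      continuous phi -> continuous psi ->
      hnorm phi <= r -> hnorm psi <= r -> enorm u <= r ->
      enorm (f t phi u - f t psi u) <= L * hnorm (phi \- psi).

Definition locally_lipschitz3 (m : nat)
    (f : R -> history tau n -> 'rV[R]_m -> 'rV[R]_n) : Prop :=
  forall r : R, exists L : R,
    forall (t : R) (phi : history tau n) (u v : 'rV[R]_m), 0 <= t <= r ->
      continuous phi -> hnorm phi <= r -> enorm u <= r -> enorm v <= r ->
      enorm (f t phi u - f t phi v) <= L * enorm (u - v).

End FunctionClasses.

Section Systems.
Context (R : realType) (tau : {posnum R}) (n m : nat).
Context (f : R -> history tau n -> 'rV[R]_m -> 'rV[R]_n).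
Context (k : 'rV[R]_n -> 'rV[R]_m).

(* [x] solves x'(t) = f(t, x_t, u(t)) on [t0, T), where T may be +oo, with
   x_{t0} = phi. The derivative is the right-hand one, since [u] jumps at the
   sampling instants. Values of [x] outside [t0 - tau, T) are irrelevant. *)
Definition solution (u : R -> 'rV[R]_m) (t0 : R) (phi : history tau n)
    (T : \bar R) (x : R -> 'rV[R]_n) : Prop :=
  [/\ (t0%:E < T)%E,
      {within [set t : R | t0 - tau%:num <= t /\ (t%:E < T)%E], continuous x},
      hist tau x t0 = phi &
      forall t : R, t0 <= t -> (t%:E < T)%E ->
        h^-1 *: (x (t + h) - x t) @[h --> 0^'+] --> f t (hist tau x t) (u t)].

(* epsilon(t) = x(t_i) - x(t), for the last sampled state [v] = x(t_i). *)
Definition sampling_error (v : 'rV[R]_n) (x : R -> 'rV[R]_n) (t : R) :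
  'rV[R]_n := v - x t.

Definition feedback (eps x : R -> 'rV[R]_n) (t : R) : 'rV[R]_m :=
  k (x t + eps t).

(* A trajectory of the closed-loop system between two consecutive sampling
   instants: [v] is the last sampled state. *)
Definition held_solution (v : 'rV[R]_n) (t0 : R) (phi : history tau n)
    (T : \bar R) (x : R -> 'rV[R]_n) : Prop :=
  solution (feedback (sampling_error v x) x) t0 phi T x.

(* Local existence of the trajectory x(t, phi) that the Dini derivative along
   the closed-loop system refers to. *)
Definition locally_solvable : Prop :=
  forall (t : R) (phi : history tau n) (v : 'rV[R]_n),
    0 <= t -> continuous phi -> exists T x, held_solution v t phi T x.

(* The value of D^+V(t, x_t) along [x]. *)
Definition dini (V : R -> history tau n -> R) (t : R) (x : R -> 'rV[R]_n) :
    \bar R :=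
  limf_esup (fun h : R =>
    ((V (t + h) (hist tau x (t + h)) - V t (hist tau x t)) / h)%:E) (0^'+).

(* [rule t e y]: the triggering equation holds at time [t], with current
   sampling error [e] and current state [y]. *)
Definition triggering_rule := R -> 'rV[R]_n -> 'rV[R]_n -> Prop.

Definition exp_rule (chi alpha1 : R -> R) (sigma a b t0 : R) :
    triggering_rule :=
  fun t e y =>
    chi (enorm e) =
      sigma * alpha1 (enorm y) + chi (a * expR (- b * (t - t0))).

(* The event times t_0, t_1, ... of [x] on [t0, T). The infimum of the empty
   set is +oo: if t_i is the last event, all later terms of the sequence are
   +oo, which is not an event time. *)
Fixpoint event_time (rule : triggering_rule) (t0 : R) (T : \bar R)
    (x : R -> 'rV[R]_n) (i : nat) : \bar R :=
  if i is j.+1 then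
    let tj := event_time rule t0 T x j in
    ereal_inf [set t%:E | t in [set t : R |
      [/\ (tj <= t%:E)%E, (t%:E < T)%E &
          rule t (sampling_error (x (fine tj)) x t) (x t)]]]
  else t0%:E.

(* The domain [t0, T) is covered by the intervals [t_i, t_{i+1}), so that T does
   not exceed an accumulation point of the event times; no regularity of [x] at
   T is assumed. *)
Definition closed_loop_solution (rule : triggering_rule) (t0 : R)
    (phi : history tau n) (T : \bar R) (x : R -> 'rV[R]_n) : Prop :=
  let te := event_time rule t0 T x in
  exists2 eps : R -> 'rV[R]_n,
    (forall t : R, t0 <= t -> (t%:E < T)%E ->
       exists2 i, (te i <= t%:E < te i.+1)%E &
                  eps t = sampling_error (x (fine (te i))) x t) &
    solution (feedback eps x) t0 phi T x.

Definition zeno (te : nat -> \bar R) : Prop :=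
  exists B : R, infinite_set [set i | (te i <= B%:E)%E].

End Systems.

Section Stability.
Context (R : realType) (tau : {posnum R}) (n : nat).
(* [sol phi T x]: [x] is a trajectory on [t0, T) with initial function phi. *)
Context (sol : history tau n -> \bar R -> (R -> 'rV[R]_n) -> Prop) (t0 : R).

Definition maximal_solution (phi : history tau n) (T : \bar R)
    (x : R -> 'rV[R]_n) : Prop :=
  sol phi T x /\
  forall T' y, sol phi T' y -> (T <= T')%E ->
    (forall t : R, t0 <= t -> (t%:E < T)%E -> y t = x t) -> T' = T.

Definition forward_complete : Prop :=
  forall (phi : history tau n) T x,
    continuous phi -> maximal_solution phi T x -> T = +oo%E.

Definition stable : Prop :=
  forall eps : R, 0 < eps -> exists2 delta : R, 0 < delta &
    forall (phi : history tau n) x,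
      continuous phi -> hnorm phi < delta -> sol phi +oo%E x ->
      forall t : R, t0 <= t -> enorm (x t) < eps.

Definition globally_attractive : Prop :=
  forall (phi : history tau n) x, continuous phi -> sol phi +oo%E x ->
    enorm (x t) @[t --> +oo] --> (0 : R).

Definition globally_asymptotically_stable : Prop :=
  [/\ forward_complete, stable & globally_attractive].

End Stability.

(* Main.v *)
Require Import Defs.
From mathcomp Require Import ring lra.

(** Write [W t] for the value of [V] along a trajectory [x] of the closed loop.
    Just after a sample the error is zero, hence below the triggering level, and
    by continuity it stays below until the next event. Between two events [x] is
    a trajectory with held control, so the Dini bound on [V] applies; the part
    [sigma * alpha1] of the triggering level is absorbed by the dissipation, and
    the upper Dini derivative of [W] is at most [- (mu - sigma) * W + threshold]
    where [threshold t = chi (a * expR (- b * (t - t0)))] tends to zero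
    ([W_dini]). A comparison argument ([barrier], [dini_decay]) turns this into:
    as soon as the threshold is below [(mu - sigma) * e], the value of [W]
    decreases at a fixed rate until it is below [e], and stays there
    ([W_decay]).

    Attractivity follows at once, and so does boundedness of [x]. On a bounded
    time interval the vector field is then bounded along [x], so [x] is
    Lipschitz. At an event the state has moved by at least
    [a * expR (- b * (t - t0))] since the previous one, so consecutive events are
    separated by a positive duration that depends only on the time horizon
    ([dwell_time]): there is no Zeno behaviour.

    If a trajectory lived on a bounded interval only, it would have finitely many
    events and, being Lipschitz, a limit at the right end; local solvability with
    the control held from there continues it ([closed_loop_extension]). Hence
    maximal trajectories are global.

    Stability does not follow from the decay of [W] alone, because the threshold
    at the initial time does not shrink with the initial function. But the
    threshold is small from some late time [M] on, so that after [M] a small [W]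
    stays small; and up to [M] a Gronwall argument keeps the state close to zero
    if it starts close enough to zero, because the sampled feedback is dominated
    by the past of the state, whenever the samples are taken
    ([finite_horizon_stability]). *)

Set Implicit Arguments.
Unset Strict Implicit.
Unset Printing Implicit Defensive.

Local Open Scope classical_set_scope.
Local Open Scope ring_scope.

(** * The Euclidean norm *)

Section EuclideanNorm.
Context (R : realType) (n : nat).
Implicit Types x y : 'rV[R]_n.

Lemma enorm_ge0 x : 0 <= enorm x.
Proof. exact: sqrtr_ge0. Qed.

Lemma sqr_enorm x : enorm x ^+ 2 = \sum_(i < n) x 0 i ^+ 2.
Proof. by rewrite sqr_sqrtr // sumr_ge0 // => i _; exact: sqr_ge0. Qed.

Lemma enorm0 : enorm (0 : 'rV[R]_n) = 0.
Proof. by rewrite /enorm big1 ?sqrtr0 // => i _; rewrite mxE expr0n. Qed.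

Lemma enormZ (c : R) x : enorm (c *: x) = `|c| * enorm x.
Proof.
rewrite /enorm -sqrtr_sqr -sqrtrM ?sqr_ge0 // mulr_sumr.
by congr Num.sqrt; apply: eq_bigr => i _; rewrite mxE exprMn.
Qed.

Lemma enormN x : enorm (- x) = enorm x.
Proof. by rewrite -scaleN1r enormZ normrN1 mul1r. Qed.

Lemma enormB x y : enorm (x - y) = enorm (y - x).
Proof. by rewrite -opprB enormN. Qed.

Lemma coord_le_enorm x i : `|x 0 i| <= enorm x.
Proof.
rewrite -sqrtr_sqr ler_sqrt; last by apply: sumr_ge0 => j _; exact: sqr_ge0.
by rewrite (bigD1 i) //= lerDl sumr_ge0 // => j _; exact: sqr_ge0.
Qed.

(** Cauchy-Schwarz: expand the nonnegative sum of the squares of the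
    coordinates of [enorm y *: x - enorm x *: y]. *)
Lemma dot_le_enorm x y : \sum_(i < n) x 0 i * y 0 i <= enorm x * enorm y.
Proof.
set A := enorm x; set B := enorm y.
have A0 : 0 <= A := enorm_ge0 x; have B0 : 0 <= B := enorm_ge0 y.
have [A00|Apos] := eqVneq A 0.
  rewrite A00 mul0r big1 // => i _; have := coord_le_enorm x i.
  by rewrite -/A A00 normr_le0 => /eqP ->; rewrite mul0r.
have [B00|Bpos] := eqVneq B 0.
  rewrite B00 mulr0 big1 // => i _; have := coord_le_enorm y i.
  by rewrite -/B B00 normr_le0 => /eqP ->; rewrite mulr0.
set D := \sum_(i < n) _.
have AB : 0 < A * B by rewrite mulr_gt0 // lt_neqAle eq_sym ?A0 ?B0 ?andbT.
have : 0 <= \sum_(i < n) (B * x 0 i - A * y 0 i) ^+ 2.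
  by apply: sumr_ge0 => i _; exact: sqr_ge0.
have -> : \sum_(i < n) (B * x 0 i - A * y 0 i) ^+ 2 =
    B ^+ 2 * A ^+ 2 + A ^+ 2 * B ^+ 2 - 2 * (A * B) * D.
  rewrite [X in _ * X + _]sqr_enorm [X in _ + _ * X - _]sqr_enorm /D !mulr_sumr.
  by rewrite -sumrN -!big_split /=; apply: eq_bigr => i _; ring.
by move=> H; rewrite -(ler_pM2l AB); nra.
Qed.

Lemma ler_enormD x y : enorm (x + y) <= enorm x + enorm y.
Proof.
rewrite -ler_sqr ?nnegrE ?addr_ge0 ?enorm_ge0 //.
rewrite sqrrD !sqr_enorm.
have -> : \sum_(i < n) (x + y) 0 i ^+ 2 = \sum_(i < n) x 0 i ^+ 2 +
    (\sum_(i < n) x 0 i * y 0 i) *+ 2 + \sum_(i < n) y 0 i ^+ 2.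
  rewrite -sumrMnl -!big_split /=; apply: eq_bigr => i _.
  by rewrite mxE sqrrD.
by rewrite lerD2r lerD2l lerMn2r dot_le_enorm.
Qed.

Lemma enorm_le_sub x y : enorm x <= enorm y + enorm (x - y).
Proof. by rewrite -{1}(subrKC y x) ler_enormD. Qed.

Lemma mx_norm_le_enorm x : `|x| <= enorm x.
Proof.
rewrite [`|x|]mx_normrE; apply/bigmax_leP; split; first exact: enorm_ge0.
by move=> [i j] _ /=; rewrite ord1; exact: coord_le_enorm.
Qed.

Lemma coord_le_mx_norm x i : `|x 0 i| <= `|x|.
Proof.
rewrite [`|x|]mx_normrE.
exact: (le_bigmax_cond _ (fun ij => `|x ij.1 ij.2|) (j := (0, i))).
Qed.

Lemma enorm_le_mx_norm x : enorm x <= n%:R * `|x|.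
Proof.
rewrite -ler_sqr ?nnegrE ?mulr_ge0 ?enorm_ge0 ?ler0n // sqr_enorm exprMn.
apply: (@le_trans _ _ (\sum_(i < n) `|x| ^+ 2)).
  by apply: ler_sum => i _; rewrite -real_normK ?num_real // ler_sqr ?nnegrE //
    coord_le_mx_norm.
rewrite sumr_const card_ord -[X in X <= _]mulr_natl ler_wpM2r ?sqr_ge0 //.
by rewrite -natrX ler_nat; case: n => [//|k]; rewrite expnS expn1 leq_pmulr.
Qed.

Lemma enorm_continuous : continuous (@enorm R n).
Proof.
move=> x; apply/(@cvgrPdist_lt _ _ _ (nbhs x) (nbhs_filter x)) => e e0.
have xnear : \forall y \near x, `|x - y| < e / n.+1%:R.
  by apply/nbhs_normP; exists (e / n.+1%:R) => //=; rewrite divr_gt0.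
near=> y.
have yx : enorm (y - x) < e.
  apply: le_lt_trans (enorm_le_mx_norm _) _.
  have : `|y - x| < e / n.+1%:R by rewrite distrC; near: y.
  rewrite ltr_pdivlMr // mulrC; apply: le_lt_trans.
  by rewrite ler_wpM2r // ler_nat.
rewrite ltr_norml; have := enorm_le_sub x y; have := enorm_le_sub y x.
by rewrite (enormB x y) => *; apply/andP; split; lra.
Unshelve. all: by end_near. Qed.

End EuclideanNorm.

(** * Continuity on intervals and comparison with a barrier *)

Lemma near_right0P (R : realType) (P : R -> Prop) :
  (\forall h \near 0^'+, P h) <->
  exists2 d : R, 0 < d & forall h, 0 < h < d -> P h.
Proof.
split=> [[d /= d0 dP]|[d d0 dP]].
  exists d => // h /andP[h0 hd]; apply: dP => //=.
  by rewrite sub0r normrN gtr0_norm.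
by near=> h; apply: dP; apply/andP; split; near: h;
  [exact: nbhs_right_gt | exact: nbhs_right_lt].
Unshelve. all: by end_near. Qed.

Definition clamp (R : realType) (lo hi s : R) : R := Num.max lo (Num.min hi s).

Section Clamp.
Context (R : realType) (lo hi : R) (lohi : lo <= hi).

Lemma clamp_itv s : lo <= clamp lo hi s <= hi.
Proof. by rewrite /clamp le_max lexx ge_max lohi ge_min lexx. Qed.

Lemma clamp_id s : lo <= s <= hi -> clamp lo hi s = s.
Proof. by move=> /andP[los shi]; rewrite /clamp min_r // max_r. Qed.

Lemma clamp_continuous : continuous (clamp lo hi).
Proof.
move=> s; apply: continuous_max; first exact: cvg_cst.
by apply: continuous_min; [exact: cvg_cst | exact: cvg_id].
Qed.

(** Composing with the projection onto [lo, hi] turns continuity on an interval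
    into continuity on the whole line, without changing the values there. *)
Lemma within_clamp_continuous (Y : topologicalType) (A : set R) (g : R -> Y) :
  `[lo, hi] `<=` A -> {within A, continuous g} ->
  continuous (g \o clamp lo hi).
Proof.
move=> sub /subspace_continuousP cg s.
apply: (@cvg_comp _ _ _ _ _ _ (within A (nbhs (clamp lo hi s)))).
  move=> P wP; have := @clamp_continuous s _ wP.
  apply: (@filterS _ (nbhs s)) => r; apply.
  by apply: sub; rewrite /= in_itv /= clamp_itv.
by apply: cg; apply: sub; rewrite /= in_itv /= clamp_itv.
Qed.

Lemma clamp_within_continuous (Y : topologicalType) (g h : R -> Y) :
  continuous h -> (forall s, lo <= s <= hi -> h s = g s) ->
  {within `[lo, hi], continuous g}.
Proof.
move=> ch hg; apply: (@subspace_eq_continuous _ _ _ h).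
  by move=> s; rewrite inE /= in_itv /= => /hg.
exact: continuous_subspaceT.
Qed.

End Clamp.

Section Barrier.
Context (R : realType).
Implicit Types (g W : R -> R).

Lemma continuous_epsdelta g (c e : R) : continuous g -> 0 < e ->
  exists2 d : R, 0 < d & forall s, `|s - c| < d -> `|g s - g c| < e.
Proof.
move=> cg e0.
have /cvgrPdist_lt /(_ _ e0) /nbhs_normP[d /= d0 dP] := cg c.
exists d => // s sc; rewrite distrC; apply: dP => /=.
by rewrite /= distrC.
Qed.

(** A continuous function that starts nonpositive and, at each of its zeros,
    stays nonpositive for a while cannot become positive: look at the end of the
    longest initial interval on which it is nonpositive. *)
Lemma barrier g (a b : R) : a <= b -> {within `[a, b], continuous g} ->
  g a <= 0 ->
  (forall t, a <= t < b -> (forall s, a <= s <= t -> g s <= 0) -> g t = 0 ->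
     \forall h \near 0^'+, g (t + h) <= 0) ->
  forall t, a <= t <= b -> g t <= 0.
Proof.
move=> ab cg ga gstep t /andP[at_ tb]; rewrite leNgt; apply/negP => gt0.
pose G := g \o clamp a b.
have cG : continuous G by apply: within_clamp_continuous cg.
have GE s : a <= s <= b -> G s = g s by move=> asb; rewrite /G /= clamp_id.
pose E := [set s | a <= s <= t /\ forall r, a <= r <= s -> g r <= 0].
have Ea : E a.
  by split=> [|r /andP[ar ra]]; rewrite ?lexx // (@le_anti _ _ r a) ?ar ?ra.
have Eub : ubound E t by move=> s [/andP[]].
have Esup : has_sup E by split; [exists a | exists t].
pose c := sup E.
have ac : a <= c by exact: (ub_le_sup Esup.2).
have ct : c <= t by apply: ge_sup => //; exists a.
have below r : a <= r < c -> g r <= 0.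
  move=> /andP[ar rc].
  have [s Es rs] := sup_adherent (eps := c - r) ltac:(by rewrite subr_gt0) Esup.
  apply: Es.2; rewrite ar /=; apply: ltW.
  by move: rs; rewrite -/c opprB addrC subrK.
have acb : a <= c <= b by rewrite ac (le_trans ct).
have gc : g c <= 0.
  rewrite leNgt; apply/negP => gc0.
  have [ca|ca] := eqVneq c a; first by move: ga; rewrite -ca leNgt gc0.
  have ltac : a < c by rewrite lt_neqAle eq_sym ca.
  have [d d0 dP] := continuous_epsdelta c cG gc0.
  pose r := Num.max a (c - d / 2).
  have arc : a <= r < c by rewrite le_max lexx /= gt_max ltac ltrBlDr ltrDl divr_gt0.
  have rc : `|r - c| < d.
    have h1 : c - d / 2 <= r by rewrite le_max lexx orbT.
    by have /andP[_ h2] := arc; rewrite ltr_norml; apply/andP; split; lra.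
  have := dP _ rc; rewrite !GE //; last first.
    by have /andP[h1 h2] := arc; rewrite h1 /=; have := ltW h2; lra.
  by have := below _ arc; rewrite ltr_norml => h /andP[]; lra.
have ltct : c < t.
  rewrite lt_neqAle ct andbT; apply: contraTneq gc => ->; by rewrite -ltNge.
have gle r : a <= r <= c -> g r <= 0.
  move=> /andP[ar]; rewrite le_eqVlt => /orP[/eqP->//|rc].
  by apply: below; rewrite ar.
have [d d0 dP] : exists2 d, 0 < d & forall h, 0 < h < d -> g (c + h) <= 0.
  have [gc0|gcn] := eqVneq (g c) 0.
    apply/near_right0P; apply: gstep => //.
    by rewrite ac /= (lt_le_trans ltct).
  have gcneg : 0 < - g c by rewrite oppr_gt0 lt_neqAle gcn.
  have [d d0 dP] := continuous_epsdelta c cG gcneg.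
  exists (Num.min d (b - c)).
    by rewrite lt_min d0 /= subr_gt0 (lt_le_trans ltct).
  move=> h; rewrite lt_min => /andP[h0 /andP[hd hb]].
  have := dP (c + h); rewrite addrC addKr gtr0_norm // => /(_ hd).
  rewrite addrC !GE //; last by apply/andP; split; lra.
  by rewrite ltr_norml => /andP[]; lra.
pose h := Num.min d (t - c) / 2.
have h0 : 0 < Num.min d (t - c) by rewrite lt_min d0 subr_gt0.
have hd : Num.min d (t - c) <= d by rewrite ge_min lexx.
have ht : Num.min d (t - c) <= t - c by rewrite ge_min lexx orbT.
have : E (c + h).
  split=> [|r /andP[ar rch]]; first by rewrite /h; apply/andP; split; lra.
  have [rc|cr] := leP r c; first by apply: gle; rewrite ar.
  rewrite -(subrKC c r); apply: dP; rewrite /h in rch; apply/andP; split; lra.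
by move=> /(ub_le_sup Esup.2); rewrite -/c /h; lra.
Qed.

End Barrier.

Section Decay.
Context (R : realType).
Implicit Types (W alpha : R -> R).

(** The upper right Dini derivative in a form without limits: every slope above
    [r] is eventually an upper bound. *)
Definition dini_le W (t r : R) : Prop :=
  forall q, r < q -> \forall h \near 0^'+, W (t + h) <= W t + q * h.

(** Where [W] meets the barrier it is at least [e], and there the differential
    inequality makes it decrease faster than [s], which is the slope of the
    barrier at most. *)
Lemma dini_decay W (a b lam c e s : R) : a <= b -> 0 < lam -> 0 <= s ->
  s < lam * e - c -> {within `[a, b], continuous W} ->
  (forall t, a <= t < b -> dini_le W t (- lam * W t + c)) ->
  forall t, a <= t <= b -> W t <= Num.max e (W a - s * (t - a)).
Proof.
move=> ab lam0 s0 slt cW dW t tab; rewrite -subr_le0.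
pose B u := Num.max e (W a - s * (u - a)).
apply: (@barrier _ (fun u => W u - B u) a b) tab => //.
- move=> u; apply: cvgB; first exact: cW.
  apply: continuous_subspaceT => {}u.
  apply: (@continuous_max _ _ (fun=> e) (fun u => W a - s * (u - a))).
    exact: cvg_cst.
  apply: cvgB; first exact: cvg_cst; apply: cvgM; first exact: cvg_cst.
  by apply: cvgB; [exact: cvg_id | exact: cvg_cst].
- by rewrite /B subrr mulr0 subr0 subr_le0 le_max lexx orbT.
move=> u uab _ /eqP; rewrite subr_eq0 => /eqP WB.
have eB : e <= B u by rewrite le_max lexx.
have : - lam * W u + c < - s by rewrite WB; nra.
move=> /(dW _ uab); apply: filter_app; near=> h => Wh.
have h0 : 0 < h by near: h; exact: nbhs_right_gt.
rewrite subr_le0; apply: le_trans Wh _; rewrite WB {1}/B /B.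
rewrite addr_maxl ge_max !le_max; apply/andP; split.
  by apply/orP; left; nra.
by apply/orP; right; nra.
Unshelve. all: by end_near. Qed.

(** * Comparison functions *)

Section ClassK.
Context (alpha : R -> R) (alphaK : classK alpha).

Lemma classK0 : alpha 0 = 0. Proof. by case: alphaK. Qed.

Lemma classK_lt s r : 0 <= s -> s < r -> alpha s < alpha r.
Proof.
case: alphaK => _ inc _ s0 sr; apply: inc => //; rewrite in_itv /= andbT //.
exact: le_trans (ltW sr).
Qed.

Lemma classK_le s r : 0 <= s -> s <= r -> alpha s <= alpha r.
Proof.
by move=> s0; rewrite le_eqVlt => /predU1P[->//|/(classK_lt s0)/ltW].
Qed.

Lemma classK_gt0 s : 0 < s -> 0 < alpha s.
Proof. by rewrite -{2}classK0; exact: classK_lt. Qed.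

Lemma classK_ge0 s : 0 <= s -> 0 <= alpha s.
Proof. by rewrite -{2}classK0; exact: classK_le. Qed.

Lemma classK_ltP s r : 0 <= r -> alpha s < alpha r -> s < r.
Proof. by move=> r0; rewrite !ltNge; apply: contra; exact: classK_le. Qed.

Lemma classK_leP s r : 0 <= r -> alpha s <= alpha r -> s <= r.
Proof. by move=> r0; rewrite !leNgt; apply: contra; exact: classK_lt. Qed.

(** The absolute value extends [alpha], which is arbitrary on negative numbers,
    to a function that is continuous on the whole line. *)
Lemma classK_abs_continuous : continuous (fun s : R => alpha `|s|).
Proof.
move=> /= s; case: alphaK => /subspace_continuousP ca _ _.
apply: (@cvg_comp _ _ _ _ _ _ (within `[0, +oo[ (nbhs `|s|))).
  move=> P wP; have := @norm_continuous _ R s _ wP.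
  by apply: (@filterS _ (nbhs s)) => r; apply; rewrite /= in_itv /= normr_ge0.
by apply: ca; rewrite /= in_itv /= normr_ge0.
Qed.

Lemma classK_small e : 0 < e -> exists2 d, 0 < d & alpha d < e.
Proof.
move=> e0; have [d d0 dP] := continuous_epsdelta 0 classK_abs_continuous e0.
exists (d / 2); first by rewrite divr_gt0.
have := dP (d / 2); rewrite subr0 gtr0_norm ?divr_gt0 // normr0 classK0 subr0.
move=> /(_ ltac:(lra)); exact: le_lt_trans (ler_norm _).
Qed.

End ClassK.
End Decay.

(** * Histories *)

Section Histories.
Context (R : realType) (tau : {posnum R}) (n : nat).
Implicit Types phi : history tau n.

Lemma set_val_delay (s : delay_interval tau) : - tau%:num <= set_val s <= 0.
Proof. by have := valP s; rewrite inE /= in_itv. Qed.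

Lemma hnorm_le phi r : (forall s, enorm (phi s) <= r) -> hnorm phi <= r.
Proof.
move=> phir; apply: ge_sup; first by exists (enorm (phi (now tau))), (now tau).
by move=> _ [s _ <-].
Qed.

(** The supremum that defines [hnorm] is junk on unbounded sets; a continuous
    history is bounded since [- tau, 0] is compact. *)
Lemma enorm_le_hnorm phi s : continuous phi -> enorm (phi s) <= hnorm phi.
Proof.
move=> cphi; pose g (r : R) := phi (insubd (now tau) r).
have gE s' : g (set_val s') = phi s' by rewrite /g; congr phi; exact: valKd.
have cg : {within `[- tau%:num, 0], continuous (fun r => enorm (g r))}.
  apply/subspace_sigL_continuousP.
  rewrite (_ : sigL _ _ = @enorm R n \o phi); last first.
    by apply/funext => s'; rewrite /= -gE.
  by move=> s'; apply: continuous_comp; [exact: cphi | exact: enorm_continuous].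
have [|c _ cmax] := EVT_max _ cg; first by rewrite oppr_le0.
apply: ub_le_sup; last by exists s.
exists (enorm (g c)) => _ [s' _ <-]; rewrite -gE; apply: cmax.
by rewrite in_itv /= set_val_delay.
Qed.

Lemma hnorm_ge0 phi : continuous phi -> 0 <= hnorm phi.
Proof. by move/(enorm_le_hnorm (now tau)); apply: le_trans; exact: enorm_ge0. Qed.

Lemma hist_continuous (x : R -> 'rV[R]_n) (t : R) :
  {within `[t - tau%:num, t], continuous x} -> continuous (hist tau x t).
Proof.
move=> cx; apply/(subspace_sigL_continuousP _ (fun r => x (t + r))).
have le_t : t - tau%:num <= t by rewrite gerBl.
have cX := within_clamp_continuous le_t (@subset_refl _ _) cx.
apply: (@clamp_within_continuous _ _ _ _ _
  ((x \o clamp (t - tau%:num) t) \o (+%R t))).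
  move=> r; apply: continuous_comp; last exact: cX.
  by apply: cvgD; [exact: cvg_cst | exact: cvg_id].
move=> s /andP[s1 s2] /=; rewrite clamp_id //; apply/andP; split; lra.
Qed.

Lemma hist_now (x : R -> 'rV[R]_n) t : hist tau x t (now tau) = x t.
Proof. by rewrite /hist /= addr0. Qed.

End Histories.

(** * Trajectories *)

Section Trajectories.
Context (R : realType) (tau : {posnum R}) (n m : nat).
Context (f : R -> history tau n -> 'rV[R]_m -> 'rV[R]_n).

Lemma dini_dini_le (V : R -> history tau n -> R) (t r : R) (x : R -> 'rV[R]_n) :
  (dini V t x <= r%:E)%E -> dini_le (fun u => V u (hist tau x u)) t r.
Proof.
move=> Vr q rq; have : (dini V t x < q%:E)%E by apply: le_lt_trans Vr _; rewrite lte_fin.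
rewrite /dini limf_esupE => /ereal_inf_lt[_ [A A0 <-] supA].
have : \forall h \near 0^'+, A h by exact: A0.
apply: filter_app; near=> h => Ah.
have h0 : 0 < h by near: h; exact: nbhs_right_gt.
rewrite -lerBlDl -ler_pdivrMr // -lee_fin; apply: ltW.
by apply: le_lt_trans supA; apply: ereal_sup_ubound; exists h.
Unshelve. all: by end_near. Qed.

Lemma right_derivative_bound (x : R -> 'rV[R]_n) (t K : R) (v : 'rV[R]_n) :
  h^-1 *: (x (t + h) - x t) @[h --> 0^'+] --> v -> enorm v < K ->
  \forall h \near 0^'+, enorm (x (t + h) - x t) <= K * h.
Proof.
move=> xv vK.
have : enorm (h^-1 *: (x (t + h) - x t)) @[h --> 0^'+] --> enorm v.
  by apply: continuous_cvg => //; exact: enorm_continuous.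
move=> /cvgr_lt /(_ _ vK); apply: filter_app; near=> h.
have h0 : 0 < h by near: h; exact: nbhs_right_gt.
by rewrite enormZ ger0_norm ?invr_ge0 ?(ltW h0) // ltr_pdivrMl // (mulrC K) => /ltW.
Unshelve. all: by end_near. Qed.

(** A right derivative is enough for the mean value inequality: the distance to
    [x s] cannot cross the line of slope [K] through zero at time [s]. *)
Lemma right_derivative_lipschitz (x x' : R -> 'rV[R]_n) (a b K : R) :
  {within `[a, b], continuous x} ->
  (forall t, a <= t < b ->
     h^-1 *: (x (t + h) - x t) @[h --> 0^'+] --> x' t /\ enorm (x' t) < K) ->
  forall s t, a <= s -> s <= t -> t <= b -> enorm (x t - x s) <= K * (t - s).
Proof.
move=> cx dx s t as_ st tb; rewrite -subr_le0.
apply: (@barrier _ (fun u => enorm (x u - x s) - K * (u - s)) s b).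
- exact: le_trans tb.
- have cxs : {within `[s, b], continuous x}.
    apply: continuous_subspaceW cx => u /=; rewrite !in_itv /=.
    by move=> /andP[su ->]; rewrite (le_trans as_).
  have cl : continuous (fun u => K * (u - s)).
    move=> u; apply: cvgM; first exact: cvg_cst.
    by apply: cvgB; [exact: cvg_id | exact: cvg_cst].
  move=> u; apply: cvgB; last exact: (continuous_subspaceT cl).
  apply: continuous_cvg; first exact: enorm_continuous.
  by apply: cvgB; [exact: cxs | exact: cvg_cst].
- by rewrite !subrr mulr0 enorm0 subr0.
- move=> u /andP[su ub] _ /eqP; rewrite subr_eq0 => /eqP xus.
  have [|xu xK] := dx u; first by rewrite (le_trans as_ su) ub.
  have := right_derivative_bound xu xK; apply: filter_app; near=> h => xh.
  have := ler_enormD (x (u + h) - x u) (x u - x s).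
  by rewrite subrKA; lra.
- by rewrite st tb.
Unshelve. all: by end_near. Qed.

Section Solution.
Context (u : R -> 'rV[R]_m) (t0 : R) (phi : history tau n) (T : \bar R)
  (x : R -> 'rV[R]_n) (xsol : solution f u t0 phi T x).

Lemma solution_continuous S : t0 <= S -> (S%:E < T)%E ->
  {within `[t0 - tau%:num, S], continuous x}.
Proof.
move=> t0S ST; case: xsol => _ cx _ _; apply: continuous_subspaceW cx.
move=> s /=; rewrite in_itv /= => /andP[-> sS]; split=> //.
by apply: le_lt_trans ST; rewrite lee_fin.
Qed.

Lemma solution_hist_continuous t : t0 <= t -> (t%:E < T)%E ->
  continuous (hist tau x t).
Proof.
move=> t0t tT; apply: hist_continuous.
apply: continuous_subspaceW (solution_continuous t0t tT) => s /=.
by rewrite !in_itv /= => /andP[ts ->]; rewrite andbT; lra.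
Qed.

Lemma solution_initial s : - tau%:num <= s <= 0 ->
  exists2 s' : delay_interval tau, x (t0 + s) = phi s' & set_val s' = s.
Proof.
move=> s0; have s_in : s \in `[- tau%:num, 0 : R]%classic by rewrite inE /= in_itv.
by exists (exist _ s s_in) => //; case: xsol => _ _ <- _.
Qed.

End Solution.

(** Along a trajectory [V] is continuous: on a compact time interval the
    trajectory coincides with a function that is continuous on the whole line,
    to which the definitions of the two function classes apply. *)
Lemma solution_V_continuous (V1 : R -> 'rV[R]_n -> R) (V2 : R -> history tau n -> R)
    u t0 phi T x S :
  classV0 V1 -> classV0star V2 -> solution f u t0 phi T x -> 0 <= t0 ->
  t0 <= S -> (S%:E < T)%E ->
  {within `[t0, S], continuous
     (fun t => V1 t (hist tau x t (now tau)) + V2 t (hist tau x t))}.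
Proof.
move=> [_ cV1] [_ cV2 _] xsol t00 t0S ST.
have lohi : t0 - tau%:num <= S by apply: le_trans t0S; rewrite gerBl.
pose X := x \o clamp (t0 - tau%:num) S.
have cX : continuous X.
  exact: within_clamp_continuous (@subset_refl _ _) (solution_continuous xsol t0S ST).
have XE s : t0 - tau%:num <= s <= S -> X s = x s by move=> sS; rewrite /X /= clamp_id.
have cW : {within `[0, +oo[, continuous (fun t => V1 t (X t) + V2 t (hist tau X t))}.
  move=> t; apply: cvgD.
    by apply: cV1; exact: continuous_subspaceT.
  by apply: cV2; exact: continuous_subspaceT.
apply: (@subspace_eq_continuous _ _ _ (fun t => V1 t (X t) + V2 t (hist tau X t))).
  move=> s; rewrite inE /= in_itv /= => /andP[t0s sS].
  have -> : hist tau X s = hist tau x s.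
    apply/funext => r; rewrite /hist XE //; have := set_val_delay r.
    by move=> /andP[r1 r2]; apply/andP; split; lra.
  by rewrite /from_subspace hist_now XE // sS andbT; apply: le_trans t0s; rewrite gerBl.
apply: continuous_subspaceW cW => s /=; rewrite !in_itv /= andbT.
by case/andP=> /(le_trans t00).
Qed.

(** * Bounds on the vector field and on the feedback law *)

(** Compare with the equilibrium, first in the history and then in the control. *)
Lemma vector_field_bound (f0 : forall t : R, 0 <= t -> f t (fun=> 0) 0 = 0) :
  locally_lipschitz2 f -> locally_lipschitz3 f ->
  forall r : R, exists2 K : R, 0 <= K & forall t phi u, 0 <= t <= r ->
    continuous phi -> hnorm phi <= r -> enorm u <= r ->
    enorm (f t phi u) <= K * (hnorm phi + enorm u).
Proof.
move=> lf2 lf3 r; have [K2 HK2] := lf2 r; have [K3 HK3] := lf3 r.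
exists (`|K2| + `|K3|); first by rewrite addr_ge0.
move=> t phi u tr cphi phir ur.
have r0 : 0 <= r by exact: le_trans (enorm_ge0 u) ur.
have c0 : continuous ((fun=> 0) : history tau n) by exact: cst_continuous.
have h0 : hnorm ((fun=> 0) : history tau n) <= 0 by apply: hnorm_le => s; rewrite enorm0.
have := HK2 t phi (fun=> 0) u tr cphi c0 phir (le_trans h0 r0) ur.
have -> : phi \- (fun=> 0) = phi by apply/funext => s /=; rewrite subr0.
have := HK3 t (fun=> 0) u 0 tr c0 (le_trans h0 r0) ur; rewrite enorm0 => /(_ r0).
have /andP[t_ge0 _] := tr.
rewrite f0 // !subr0 => H3 H2.
apply: le_trans (enorm_le_sub _ (f t (fun=> 0) u)) _.
have p0 := hnorm_ge0 cphi; have q0 := enorm_ge0 u.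
have := ler_wpM2r p0 (ler_norm K2); have := ler_wpM2r q0 (ler_norm K3).
have := mulr_ge0 (normr_ge0 K2) q0; have := mulr_ge0 (normr_ge0 K3) p0.
by rewrite mulrDl !mulrDr; lra.
Qed.

Context (k : 'rV[R]_n -> 'rV[R]_m).
Hypothesis k_lip : [locally [lipschitz k y | y in setT]].

(** The definition bounds pairs of points near the pair [(y0, y0)]; one of the two
    is fixed to [y0]. *)
Lemma locally_lipschitz_at (y0 : 'rV[R]_n) : exists2 d : R, 0 < d &
  exists2 L : R, 0 <= L &
  forall y, `|y - y0| < d -> `|k y - k y0| <= L * `|y - y0|.
Proof.
have := @k_lip (y0, y0) (conj I I) => /pinfty_ex_gt0[L L0].
rewrite /dominated_by /within /= => -[[A B] /= [nA nB] AB].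
have : \forall y \near y0, `|k y - k y0| <= L * `|y - y0|.
  apply: (@filterS _ (nbhs y0)) nA => y Ay.
  by apply: (AB (y, y0)); split => //; exact: (nbhs_singleton nB).
move=> /nbhs_normP[d /= d0 dP]; exists d => //; exists L; first exact: ltW.
by move=> y yd; apply: dP => /=; rewrite distrC.
Qed.

Lemma feedback_continuous : continuous k.
Proof.
move=> y0; apply/(@cvgrPdist_lt _ _ _ (nbhs y0) (nbhs_filter y0)) => e e0.
have [d d0 [L L0 kL]] := locally_lipschitz_at y0.
suff : \forall y \near y0, `|k y0 - k y| < e by [].
apply/nbhs_normP; exists (Num.min d (e / (L + 1))) => /=.
  by rewrite lt_min d0 divr_gt0 // ltr_wpDl.
move=> y; rewrite /= lt_min distrC => /andP[/kL ky].
rewrite ltr_pdivlMr ?ltr_wpDl // (distrC (k y0)) => ye.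
have := normr_ge0 (y - y0); nra.
Qed.

(** On bounded sets the feedback law is bounded, since these sets are relatively
    compact. *)
Lemma feedback_bounded (r : R) :
  exists C : R, forall y, enorm y <= r -> enorm (k y) <= C.
Proof.
pose A := [set y : 'rV[R]_n | enorm y <= r].
have [r0|r0] := ltP r 0.
  by exists 0 => y yr; have := enorm_ge0 y; lra.
have A0 : A !=set0 by exists 0; rewrite /A /= enorm0.
have cA : compact A.
  apply: bounded_closed_compact.
    exists r; split; first by rewrite num_real.
    by move=> M rM y Ay; apply: le_trans (mx_norm_le_enorm _) (le_trans Ay (ltW rM)).
  have -> : A = @enorm R n @^-1` [set s | s <= r] by [].
  by apply: preimage_closed (@closed_le _ _); move=> y _; exact: enorm_continuous.
have ck : {within A, continuous (fun y => enorm (k y))}.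
  apply: continuous_subspaceT => y.
  apply: (@continuous_comp _ _ _ k (@enorm R m)); first exact: feedback_continuous.
  exact: enorm_continuous.
have [c _ cmax] := compact_EVT_max A0 cA ck.
by exists (enorm (k c)) => y yr; apply: cmax; rewrite inE.
Qed.

Lemma feedback_small : k 0 = 0 -> exists2 d : R, 0 < d &
  exists2 L : R, 0 <= L & forall y, enorm y <= d -> enorm (k y) <= L * enorm y.
Proof.
move=> k0; have [d d0 [L L0 kL]] := locally_lipschitz_at 0.
exists (d / 2); first by rewrite divr_gt0.
exists (m%:R * L); first by rewrite mulr_ge0 // ler0n.
move=> y yd; apply: le_trans (enorm_le_mx_norm _) _; rewrite -mulrA ler_wpM2l ?ler0n //.
have yn := mx_norm_le_enorm y.
have := kL y; rewrite k0 !subr0 => /(_ _)/le_trans; apply; last by rewrite ler_wpM2l.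
by apply: le_lt_trans yn _; lra.
Qed.

End Trajectories.

(** * Event times *)

(** The zeros of [g] in [r, S] form a compact set. *)
Lemma closed_zero_set_min (R : realType) (g : R -> R) (r S : R) :
  continuous g -> r <= S -> g S = 0 ->
  exists2 s, r <= s <= S /\ g s = 0 & forall t, r <= t <= S -> g t = 0 -> s <= t.
Proof.
move=> cg rS gS; pose E := `[r, S] `&` g @^-1` [set 0].
have cE : compact E.
  apply: compact_closedI; first exact: segment_compact.
  apply: preimage_closed; last exact: closed_eq.
  by move=> t _; exact: cg.
have E0 : E !=set0 by exists S; split; rewrite //= in_itv /= rS lexx.
have cid : {within E, continuous (@id R)}.
  by apply: continuous_subspaceT => t; exact: cvg_id.
have [s + smin] := compact_EVT_min E0 cE cid.
rewrite inE /E /= in_itv /= => sE; exists s => // t tS gt.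
by apply: smin; rewrite inE /E /= in_itv.
Qed.

Section EventTimeRecurrence.
Context (R : realType) (n : nat) (rule : triggering_rule R n).
Context (x : R -> 'rV[R]_n) (t0 : R) (T : \bar R).
Let te := event_time rule t0 T x.

Lemma event_time_next i r s : te i = r%:E -> r <= s -> (s%:E < T)%E ->
  rule s (x r - x s) (x s) ->
  (forall t, r <= t -> (t%:E < T)%E -> rule t (x r - x t) (x t) -> s <= t) ->
  te i.+1 = s%:E.
Proof.
move=> ti rs sT rules smin; rewrite /te /= -/te ti /=; apply/eqP.
rewrite eq_le; apply/andP; split.
  by apply: ereal_inf_lbound; exists s => //; split.
apply: le_ereal_inf_tmp => _ [t [rt tT rulet] <-]; rewrite lee_fin.
by apply: smin; rewrite // -lee_fin.
Qed.

Lemma event_time_last i r : te i = r%:E ->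
  (forall t, r <= t -> (t%:E < T)%E -> ~ rule t (x r - x t) (x t)) ->
  te i.+1 = +oo%E.
Proof.
move=> ti norule; rewrite /te /= -/te ti /= -[RHS]ereal_inf0; congr ereal_inf.
rewrite -subset0 => _ [t [rt tT rulet] <-].
by apply: (norule t); rewrite // -lee_fin.
Qed.

Lemma event_time_infinite i : te i = +oo%E -> te i.+1 = +oo%E.
Proof.
move=> ti; rewrite /te /= -/te ti /= -[RHS]ereal_inf0; congr ereal_inf.
by rewrite -subset0 => y [t []]; rewrite leye_eq.
Qed.

End EventTimeRecurrence.

(** A triggering rule is taken here as the zero set of a function [g] that is
    continuous along continuous trajectories and negative when the error is
    zero. *)
Section EventTimes.
Context (R : realType) (n : nat).
Context (rule : triggering_rule R n) (g : R -> 'rV[R]_n -> 'rV[R]_n -> R).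
Hypothesis ruleP : forall t e y, rule t e y <-> g t e y = 0.
Hypothesis g_continuous : forall (x : R -> 'rV[R]_n) v, continuous x ->
  continuous (fun t => g t (v - x t) (x t)).
Hypothesis g_reset : forall t y, g t 0 y < 0.

Section Below.
Context (x : R -> 'rV[R]_n) (r S : R) (v : 'rV[R]_n).
Hypotheses (rS : r <= S) (x_continuous : {within `[r, S], continuous x}).

Lemma first_trigger : rule S (v - x S) (x S) ->
  exists2 s, r <= s <= S /\ rule s (v - x s) (x s) &
    forall t, r <= t -> rule t (v - x t) (x t) -> s <= t.
Proof.
move=> /ruleP gS; pose X := x \o clamp r S.
have cX : continuous X := within_clamp_continuous rS (@subset_refl _ _) x_continuous.
have XE s : r <= s <= S -> X s = x s by move=> sS; rewrite /X /= clamp_id.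
have [|s [rsS gs] smin] := closed_zero_set_min (@g_continuous X v cX) rS.
  by rewrite XE ?rS ?lexx.
exists s; first by split=> //; apply/ruleP; rewrite -XE.
move=> t rt /ruleP gt; have [tS|St] := leP t S.
  by apply: smin; rewrite ?rt ?XE ?rt.
by apply: le_trans (ltW St); case/andP: rsS.
Qed.

(** By the intermediate value theorem the triggering function vanishes before it
    can become positive. *)
Lemma below_threshold : g r (v - x r) (x r) < 0 ->
  (forall s, r <= s <= S -> ~ rule s (v - x s) (x s)) ->
  g S (v - x S) (x S) < 0.
Proof.
move=> gr norule; rewrite ltNge; apply/negP => gS.
pose X := x \o clamp r S.
have cX : continuous X := within_clamp_continuous rS (@subset_refl _ _) x_continuous.
have XE s : r <= s <= S -> X s = x s by move=> sS; rewrite /X /= clamp_id.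
have [] := @IVT R (fun t => g t (v - X t) (X t)) r S 0 rS.
- by apply: continuous_subspaceT; exact: (@g_continuous X v cX).
- by rewrite !XE ?rS ?lexx // ge_min le_max gS (ltW gr) orbT.
move=> s; rewrite in_itv /= => sS; rewrite XE //.
by move/ruleP; exact: norule.
Qed.

End Below.

Context (x : R -> 'rV[R]_n) (t0 : R) (T : \bar R).
Let te := event_time rule t0 T x.

Hypothesis t0T : (t0%:E < T)%E.
Hypothesis x_continuous : forall S, t0 <= S -> (S%:E < T)%E ->
  {within `[t0, S], continuous x}.

Lemma within_from r S : t0 <= r -> t0 <= S -> (S%:E < T)%E ->
  {within `[r, S], continuous x}.
Proof.
move=> t0r t0S ST; apply: continuous_subspaceW (x_continuous t0S ST) => s /=.
by rewrite !in_itv /= => /andP[rs ->]; rewrite (le_trans t0r).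
Qed.

(** The infimum that defines the next event time is attained, and the next event
    is strictly later because the triggering function is negative at the reset. *)
Lemma event_timeS i r : te i = r%:E -> t0 <= r ->
  (exists s, [/\ te i.+1 = s%:E, r < s, (s%:E < T)%E,
     rule s (x r - x s) (x s) &
     forall t, r <= t -> rule t (x r - x t) (x t) -> s <= t]) \/
  (te i.+1 = +oo%E /\
     forall t, r <= t -> (t%:E < T)%E -> ~ rule t (x r - x t) (x t)).
Proof.
move=> ti t0r.
have [[S [rS ST ruleS]]|noS] := pselect (exists S,
    [/\ r <= S, (S%:E < T)%E & rule S (x r - x S) (x S)]); last first.
  right; have norule t : r <= t -> (t%:E < T)%E -> ~ rule t (x r - x t) (x t).
    by move=> rt tT rulet; apply: noS; exists t.
  by split=> //; exact: event_time_last ti norule.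
left; have t0S := le_trans t0r rS.
have [s [/andP[rs sS] rules] smin] :=
  first_trigger rS (within_from t0r t0S ST) ruleS.
have sT : (s%:E < T)%E by apply: le_lt_trans ST; rewrite lee_fin.
exists s; split=> //.
- by apply: (event_time_next ti) => // t rt _; exact: smin.
- rewrite lt_neqAle rs andbT; apply/eqP => rs'; move/ruleP: rules.
  by rewrite -rs' subrr => /eqP; rewrite lt_eqF.
Qed.

Lemma event_timeP i : te i = +oo%E \/
  exists2 r, te i = r%:E & t0 <= r /\ (r%:E < T)%E.
Proof.
elim: i => [|i [ti|[r ti [t0r rT]]]]; first by right; exists t0.
  by left; exact: event_time_infinite.
have [[s [ts rs sT _ _]]|[ts _]] := event_timeS ti t0r; last by left.
by right; exists s => //; split=> //; apply: le_trans t0r (ltW rs).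
Qed.

Lemma event_time_le_fin i r : (te i <= r%:E)%E ->
  exists2 s, te i = s%:E & [/\ t0 <= s, (s%:E < T)%E & s <= r].
Proof.
have [->|[s -> [t0s sT]]] := event_timeP i; first by rewrite leye_eq.
by rewrite lee_fin => sr; exists s.
Qed.

Lemma event_time_homo i j : (i <= j)%N -> (te i <= te j)%E.
Proof.
elim: j => [|j IH]; first by rewrite leqn0 => /eqP->.
rewrite leq_eqVlt => /predU1P[->//|]; rewrite ltnS => /IH ij.
apply: le_trans ij _; have [tj|[r tj [t0r rT]]] := event_timeP j.
  by rewrite /te (event_time_infinite tj) leey.
have [[s [ts rs _ _ _]]|[ts _]] := event_timeS tj t0r.
  by rewrite tj ts lee_fin ltW.
by rewrite ts leey.
Qed.

Lemma event_interval_unique i j t : (te i <= t%:E < te i.+1)%E ->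
  (te j <= t%:E < te j.+1)%E -> i = j.
Proof.
move=> /andP[i1 i2] /andP[j1 j2].
case: (ltngtP i j) => // /event_time_homo.
  by move=> /le_trans /(_ j1) /(lt_le_trans i2); rewrite ltxx.
by move=> /le_trans /(_ i1) /(lt_le_trans j2); rewrite ltxx.
Qed.

Lemma below_threshold_before_next i r t : te i = r%:E -> t0 <= r -> r <= t ->
  (t%:E < T)%E -> (t%:E < te i.+1)%E -> g t (x r - x t) (x t) < 0.
Proof.
move=> ti t0r rt tT tnext; apply: (below_threshold rt).
- exact: (within_from t0r (le_trans t0r rt) tT).
- by rewrite subrr.
move=> s /andP[rs st] rules; move: tnext.
have [[s' [-> _ _ _ smin]]|[_ norule]] := event_timeS ti t0r.
  by rewrite lte_fin ltNge => /negP; apply; apply: le_trans st; exact: smin.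
by move=> _; apply: (norule s); rewrite //; apply: le_lt_trans tT; rewrite lee_fin.
Qed.

(** Finite event times depend only on the past of the trajectory. *)
Lemma event_time_extension (z : R -> 'rV[R]_n) (T' : \bar R) i r :
  (T <= T')%E -> (forall t, t0 <= t -> (t%:E < T)%E -> z t = x t) ->
  te i = r%:E -> event_time rule t0 T' z i = r%:E.
Proof.
move=> TT' zx; elim: i r => [//|i IH] s tis.
have [ti|[r ti [t0r rT]]] := event_timeP i.
  by rewrite /te (event_time_infinite ti) in tis.
have zi := IH _ ti.
have [[s' [ts rs sT rules smin]]|[ts _]] := event_timeS ti t0r; last first.
  by rewrite ts in tis.
move: tis; rewrite ts => -[<-{s}].
have t0s' : t0 <= s' by apply: le_trans t0r (ltW rs).
apply: (event_time_next zi); first exact: ltW.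
- exact: lt_le_trans TT'.
- by rewrite !zx.
move=> t rt tT'; rewrite leNgt => rulet; apply/negP => ts'.
have tT : (t%:E < T)%E by apply: lt_trans sT; rewrite lte_fin.
move: rulet; rewrite !zx ?(le_trans t0r) // => /(smin _ rt).
by rewrite leNgt ts'.
Qed.

End EventTimes.

(** * Extension beyond a finite time *)

Section LeftLimit.
Context (R : realType) (n : nat).
Implicit Types x : R -> 'rV[R]_n.

(** Lipschitz functions map the left neighbourhoods of [b] to a Cauchy filter. *)
Lemma lipschitz_left_limit x (a b K : R) : a < b -> 0 < K ->
  (forall s t, a <= s -> s <= t -> t < b -> enorm (x t - x s) <= K * (t - s)) ->
  exists l : 'rV[R]_n, x t @[t --> b^'-] --> l.
Proof.
move=> ab K0 xK; apply/cvg_ex; apply: cauchy_cvg; apply: cauchy_exP => e e0.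
pose s := Num.max a (b - e / (2 * K)).
have eK : 0 < e / (2 * K) by rewrite divr_gt0 // mulr_gt0.
have as_ : a <= s by rewrite le_max lexx.
have sb : s < b by rewrite gt_max ab /=; lra.
have bs : b - e / (2 * K) <= s by rewrite le_max lexx orbT.
exists (x s); suff : \forall t \near b^'-, ball (x s) e (x t) by [].
near=> t.
have st : s < t by near: t; exact: nbhs_left_gt.
have tb : t < b by near: t; exact: nbhs_left_lt.
rewrite -ball_normE /= distrC; apply: le_lt_trans (mx_norm_le_enorm _) _.
apply: le_lt_trans (xK _ _ as_ (ltW st) tb) _.
have : K * (t - s) <= K * (e / (2 * K)) by rewrite ler_pM2l //; lra.
have -> : K * (e / (2 * K)) = e / 2 by field; rewrite gt_eqF.
by move=> /le_lt_trans; apply; lra.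
Unshelve. all: by end_near. Qed.

Lemma within_continuous_distP x (A : set R) :
  {within A, continuous x} <->
  (forall t, A t -> forall e, 0 < e ->
     \forall s \near t, A s -> `|x t - x s| < e).
Proof.
split=> [/subspace_continuousP cx t At e e0|cx].
  by move/cvgrPdist_lt: (cx t At) => /(_ e e0); rewrite !near_withinE.
apply/subspace_continuousP => t At; apply/cvgrPdist_lt => e e0.
by rewrite !near_withinE; exact: cx.
Qed.

Lemma left_limit_continuous x (lo hi : R) (l : 'rV[R]_n) :
  {within [set t | lo <= t /\ (t%:E < hi%:E)%E], continuous x} ->
  x t @[t --> hi^'-] --> l ->
  {within `[lo, hi], continuous (fun t => if t < hi then x t else l)}.
Proof.
move=> /within_continuous_distP cx xl; apply/within_continuous_distP => t /=.
rewrite in_itv /= => /andP[lot]; rewrite le_eqVlt => /predU1P[->|thi] e e0.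
  rewrite ltxx; move/cvgrPdist_lt: xl => /(_ e e0); rewrite !near_withinE.
  apply: (@filterS _ (nbhs hi)) => s xs; rewrite in_itv /= => /andP[_ shi].
  by case: (ltP s hi) => [|_]; [exact: xs | rewrite subrr normr0].
rewrite thi; have thiE : (t%:E < hi%:E)%E by rewrite lte_fin.
have := cx t (conj lot thiE) e e0.
apply: filter_app; near=> s => xs.
have shi : s < hi by near: s; exact: lt_nbhsl.
by rewrite in_itv /= shi => /andP[los _]; apply: xs; split; rewrite ?lte_fin.
Unshelve. all: by end_near. Qed.

End LeftLimit.

Section Glue.
Context (R : realType) (tau : {posnum R}) (n m : nat).
Context (f : R -> history tau n -> 'rV[R]_m -> 'rV[R]_n).

(** The trajectories must agree on a whole delay interval before [Tr], so that
    after [Tr] the glued function has the same histories as [y]. *)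
Lemma solution_glue (u1 u2 : R -> 'rV[R]_m) (t0 Tr T' : R) (T2 : \bar R)
    (phi psi : history tau n) (x y : R -> 'rV[R]_n) :
  solution f u1 t0 phi Tr%:E x -> solution f u2 Tr psi T2 y ->
  (forall s, Tr - tau%:num <= s < Tr -> y s = x s) ->
  Tr < T' -> (T'%:E <= T2)%E ->
  solution f (fun t => if t < Tr then u1 t else u2 t) t0 phi T'%:E
    (fun t => if t < Tr then x t else y t).
Proof.
move=> [t0Tr cx xphi dx] [_ cy _ dy] yx TrT' T'T2.
rewrite lte_fin in t0Tr.
set z := (z in solution _ _ _ _ _ z).
have zx t : t < Tr -> z t = x t by rewrite /z => ->.
have zy t : Tr - tau%:num <= t -> z t = y t.
  by rewrite /z; case: ltP => // tT tt; rewrite yx // tt.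
split.
- by rewrite lte_fin (lt_trans t0Tr).
- apply/within_continuous_distP => t [/= t0t tT'] e e0.
  have [tTr|Trt] := ltP t Tr.
    have tTrE : (t%:E < Tr%:E)%E by rewrite lte_fin.
    rewrite (zx _ tTr).
    have := (within_continuous_distP _ _).1 cx t (conj t0t tTrE) e e0.
    apply: filter_app; near=> s => xs.
    have sTr : s < Tr by near: s; exact: lt_nbhsl.
    by move=> /= [t0s _]; rewrite zx //; apply: xs; split; rewrite ?lte_fin.
  have tautr : Tr - tau%:num < t by apply: lt_le_trans Trt; rewrite gtrBl.
  rewrite (zy _ (ltW tautr)).
  have := (within_continuous_distP _ _).1 cy t
    (conj (ltW tautr) (lt_le_trans tT' T'T2)) e e0.
  apply: filter_app; near=> s => ys.
  have sTr : Tr - tau%:num < s by near: s; exact: lt_nbhsr.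
  move=> /= [t0s sT']; rewrite zy ?(ltW sTr) //; apply: ys; split; first exact: ltW.
  exact: lt_le_trans sT' T'T2.
- rewrite -xphi; apply/funext => s; rewrite /hist zx //.
  by have /andP[_ s0] := set_val_delay s; apply: le_lt_trans t0Tr; lra.
move=> t t0t tT'; have [tTr|Trt] := ltP t Tr.
  have -> : hist tau z t = hist tau x t.
    apply/funext => s; rewrite /hist zx //.
    by have /andP[_ s0] := set_val_delay s; apply: le_lt_trans tTr; lra.
  rewrite (zx _ tTr).
  apply: cvg_trans (dx t t0t _); last by rewrite lte_fin.
  apply: near_eq_cvg; near=> h; rewrite zx //.
  by rewrite -ltrBrDl; near: h; apply: nbhs_right_lt; rewrite subr_gt0.
have -> : hist tau z t = hist tau y t.
  apply/funext => s; rewrite /hist zy //.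
  by have /andP[s0 _] := set_val_delay s; lra.
have tTr : Tr - tau%:num <= t by apply: le_trans Trt; rewrite gerBl.
rewrite (zy _ tTr).
apply: cvg_trans (dy t Trt (lt_le_trans tT' T'T2)).
apply: near_eq_cvg; near=> h; rewrite zy //.
have h0 : 0 < h by near: h; exact: nbhs_right_gt.
by apply: le_trans tTr _; rewrite lerDl ltW.
Unshelve. all: by end_near. Qed.

End Glue.

Section ClosedLoop.
Context (R : realType) (tau : {posnum R}) (n m : nat).
Context (f : R -> history tau n -> 'rV[R]_m -> 'rV[R]_n).
Context (k : 'rV[R]_n -> 'rV[R]_m) (t0 : R).
Context (V1 : R -> 'rV[R]_n -> R) (V2 : R -> history tau n -> R).
Context (alpha1 alpha2 alpha3 chi : R -> R) (mu sigma a b : R).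
Let V (t : R) (phi : history tau n) := V1 t (phi (now tau)) + V2 t phi.
Let rule := @exp_rule R n chi alpha1 sigma a b t0.
Let sol := closed_loop_solution f k rule t0.
Hypothesis t0_ge0 : 0 <= t0.
Hypothesis f0 : forall t : R, 0 <= t -> f t (fun=> 0) 0 = 0.
Hypothesis k0 : k 0 = 0.
Hypothesis f_solvable : locally_solvable f k.
Hypotheses (V1_V0 : classV0 V1) (V2_V0star : classV0star V2).
Hypotheses (alpha1_Kinf : classKinf alpha1) (alpha2_Kinf : classKinf alpha2).
Hypotheses (alpha3_Kinf : classKinf alpha3) (chiK : classK chi).
Hypothesis V_bounds : forall (t : R) (phi : history tau n), 0 <= t -> continuous phi ->
     (alpha1 (enorm (phi (now tau))) <= V1 t (phi (now tau))
        <= alpha2 (enorm (phi (now tau)))) /\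
     (0 <= V2 t phi <= alpha3 (hnorm phi)).
Hypothesis V_dini : forall (t : R) (phi : history tau n), 0 <= t -> continuous phi ->
     forall (v : 'rV[R]_n) T x, held_solution f k v t phi T x ->
       (dini V t x <=
          (- mu * V t phi + chi (enorm (sampling_error v x t)))%:E)%E.
Hypotheses (sigma_mu : 0 <= sigma < mu) (a_gt0 : 0 < a) (b_gt0 : 0 < b).
Hypothesis k_lip : [locally [lipschitz k y | y in setT]].
Hypotheses (f_lip2 : locally_lipschitz2 f) (f_lip3 : locally_lipschitz3 f).

Let alpha1K := alpha1_Kinf.1.
Let lam := mu - sigma.

Let lam_gt0 : 0 < lam.
Proof. by rewrite /lam subr_gt0; case/andP: sigma_mu. Qed.

Let sigma_ge0 : 0 <= sigma.
Proof. by case/andP: sigma_mu. Qed.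

(** * The triggering function and the error threshold *)

(** An event requires an error of at least this norm, whatever the state. *)
Definition decay_radius (t : R) : R := a * expR (- b * (t - t0)).

Lemma decay_radius_gt0 t : 0 < decay_radius t.
Proof. by rewrite mulr_gt0 // expR_gt0. Qed.

Lemma decay_radius_nonincreasing s t : s <= t -> decay_radius t <= decay_radius s.
Proof.
move=> st; rewrite /decay_radius ler_pM2l // ler_expR.
by rewrite !mulNr lerN2 ler_pM2l // lerD2r.
Qed.

Lemma decay_radius_small e : 0 < e -> exists2 M, t0 <= M & decay_radius M < e.
Proof.
(* chosen so that [b * (M - t0) = a / e], since [a / e < expR (a / e)] *)
move=> e0; exists (t0 + a / (e * b)).
  by rewrite lerDl divr_ge0 ?mulr_ge0 // ltW.
rewrite /decay_radius addrAC subrr add0r.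
have -> : - b * (a / (e * b)) = - (a / e) by field; rewrite !gt_eqF.
rewrite expRN -ltr_pdivlMr ?invr_gt0 ?expR_gt0 // invrK.
have := expR_gt1Dx (lt0r_neq0 (divr_gt0 a_gt0 e0)).
move=> H; rewrite -ltr_pdivrMl // mulrC; apply: le_lt_trans H.
by rewrite lerDr.
Qed.

Definition threshold (t : R) : R := chi (decay_radius t).

Lemma threshold_nonincreasing s t : s <= t -> threshold t <= threshold s.
Proof.
move=> st; apply: (classK_le chiK); last exact: decay_radius_nonincreasing.
exact: ltW (decay_radius_gt0 t).
Qed.

Lemma threshold_gt0 t : 0 < threshold t.
Proof. exact: (classK_gt0 chiK) (decay_radius_gt0 t). Qed.

Lemma threshold_small e : 0 < e -> exists2 M, t0 <= M & threshold M < e.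
Proof.
move=> e0; have [d d0 dP] := classK_small chiK e0.
have [M t0M Md] := decay_radius_small d0; exists M => //.
by apply: lt_trans dP; apply: (classK_lt chiK) => //; apply: ltW; exact: decay_radius_gt0.
Qed.

Definition trigger (t : R) (e y : 'rV[R]_n) : R :=
  chi (enorm e) - (sigma * alpha1 (enorm y) + threshold t).

Lemma exp_ruleP t e y : rule t e y <-> trigger t e y = 0.
Proof.
rewrite /rule /exp_rule /trigger; split=> [->|/eqP]; first by rewrite subrr.
by rewrite subr_eq0 => /eqP.
Qed.

Lemma trigger_continuous (x : R -> 'rV[R]_n) v : continuous x ->
  continuous (fun t => trigger t (v - x t) (x t)).
Proof.
move=> cx; have abs_enorm (y : 'rV[R]_n) : enorm y = `|enorm y|.
  by rewrite ger0_norm // enorm_ge0.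
have comp (al : R -> R) (y : R -> 'rV[R]_n) : classK al -> continuous y ->
    continuous (fun t => al (enorm (y t))).
  move=> alK cy t; under eq_fun => s do rewrite abs_enorm.
  apply: (@continuous_comp _ _ _ (fun s => enorm (y s)) (fun r : R => al `|r|)).
    apply: (@continuous_comp _ _ _ y (@enorm R n)); first exact: cy.
    exact: enorm_continuous.
  exact: classK_abs_continuous.
have cr : continuous decay_radius.
  move=> t; apply: cvgM; first exact: cvg_cst.
  apply: (@continuous_comp _ _ _ (fun s => - b * (s - t0)) (@expR R)); last first.
    exact: continuous_expR.
  apply: cvgM; first exact: cvg_cst.
  by apply: cvgB; [exact: cvg_id | exact: cvg_cst].
have ct : continuous threshold.
  have -> : threshold = (fun r : R => chi `|r|) \o decay_radius.
    by apply/funext => t /=; rewrite ger0_norm // ltW // decay_radius_gt0.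
  move=> t; apply: continuous_comp; first exact: cr.
  exact: classK_abs_continuous.
move=> t; apply: cvgB.
  apply: (comp chi (fun s => v - x s) chiK) => s.
  by apply: cvgB; [exact: cvg_cst | exact: cx].
apply: cvgD; last exact: ct.
by apply: cvgM; [exact: cvg_cst | exact: comp].
Qed.

Lemma trigger_reset t y : trigger t 0 y < 0.
Proof.
rewrite /trigger enorm0 (classK0 chiK) sub0r oppr_lt0 ltr_wpDl //.
  by rewrite mulr_ge0 // (classK_ge0 alpha1K) // enorm_ge0.
exact: threshold_gt0.
Qed.


(** * A trajectory of the closed loop *)

Section Trajectory.
Context (phi : history tau n) (T : \bar R) (x : R -> 'rV[R]_n).
Hypotheses (phi_continuous : continuous phi) (x_sol : sol phi T x).
Let te := event_time rule t0 T x.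

Lemma sampled_solution : exists2 u, solution f u t0 phi T x &
  forall t, t0 <= t -> (t%:E < T)%E -> exists i, [/\ (te i <= t%:E)%E,
    (t%:E < te i.+1)%E & u t = k (x (fine (te i)))].
Proof.
case: x_sol => eps cover xs; exists (feedback k eps x) => // t t0t tT.
have [i /andP[i1 i2] epsE] := cover t t0t tT; exists i; split=> //.
by rewrite /feedback epsE /sampling_error addrC subrK.
Qed.

Lemma start_lt : (t0%:E < T)%E.
Proof. by have [u []] := sampled_solution. Qed.

Lemma trajectory_continuous S : t0 <= S -> (S%:E < T)%E ->
  {within `[t0 - tau%:num, S], continuous x}.
Proof. by have [u us _] := sampled_solution; exact: solution_continuous us _. Qed.

Lemma trajectory_continuous_from S : t0 <= S -> (S%:E < T)%E ->
  {within `[t0, S], continuous x}.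
Proof.
move=> t0S ST; apply: continuous_subspaceW (trajectory_continuous t0S ST) => s /=.
by rewrite !in_itv /= => /andP[t0s ->]; rewrite (le_trans _ t0s) // gerBl.
Qed.

Lemma trajectory_hist_continuous t : t0 <= t -> (t%:E < T)%E ->
  continuous (hist tau x t).
Proof. by have [u us _] := sampled_solution; exact: solution_hist_continuous us _. Qed.

Lemma closed_event_timeP i : te i = +oo%E \/
  exists2 r, te i = r%:E & t0 <= r /\ (r%:E < T)%E.
Proof.
exact: (event_timeP exp_ruleP trigger_continuous trigger_reset start_lt
  trajectory_continuous_from).
Qed.

Lemma closed_event_timeS i r : te i = r%:E -> t0 <= r ->
  (exists s, [/\ te i.+1 = s%:E, r < s, (s%:E < T)%E,
     rule s (x r - x s) (x s) &
     forall t, r <= t -> rule t (x r - x t) (x t) -> s <= t]) \/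
  (te i.+1 = +oo%E /\
     forall t, r <= t -> (t%:E < T)%E -> ~ rule t (x r - x t) (x t)).
Proof.
exact: (event_timeS exp_ruleP trigger_continuous trigger_reset
  trajectory_continuous_from).
Qed.

Lemma closed_event_time_homo i j : (i <= j)%N -> (te i <= te j)%E.
Proof.
exact: (event_time_homo exp_ruleP trigger_continuous trigger_reset start_lt
  trajectory_continuous_from).
Qed.

Lemma sampled_control : exists2 u, solution f u t0 phi T x &
  forall t, t0 <= t -> (t%:E < T)%E -> exists i r,
    [/\ te i = r%:E, t0 <= r, r <= t, (t%:E < te i.+1)%E & u t = k (x r)].
Proof.
have [u us uk] := sampled_solution; exists u => // t t0t tT.
have [i [i1 i2 ->]] := uk t t0t tT.
have [r ti [t0r _ rt]] := event_time_le_fin exp_ruleP trigger_continuous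
  trigger_reset start_lt trajectory_continuous_from i1.
by exists i, r; rewrite /te ti.
Qed.

(** The hypothesis on the Dini derivative of [V] speaks of trajectories with held
    control that start at the current time; up to the next event, the closed loop
    restarted at [t] is one of them, because no other sample is used before. *)
Lemma held_until_next_event t : t0 <= t -> (t%:E < T)%E -> exists i r T',
  [/\ te i = r%:E, t0 <= r, r <= t, (t%:E < te i.+1)%E &
    held_solution f k (x r) t (hist tau x t) T' x].
Proof.
move=> t0t tT; have [u [_ cx xphi dx] uk] := sampled_control.
have [i [r [ti t0r rt tnext _]]] := uk t t0t tT.
exists i, r, (Order.min T (te i.+1)); split=> //; split=> //.
- by rewrite lt_min tT.
- apply: continuous_subspaceW cx => s /= [ts]; rewrite lt_min => /andP[sT _].
  by split=> //; apply: le_trans ts; lra.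
move=> s ts; rewrite lt_min => /andP[sT snext].
have [j [r' [tj t0r' rs' snext' us]]] := uk s (le_trans t0t ts) sT.
have ij : i = j.
  apply: (event_interval_unique exp_ruleP trigger_continuous trigger_reset
    start_lt trajectory_continuous_from (t := s)); rewrite -/te.
    by rewrite ti lee_fin (le_trans rt ts).
  by rewrite tj lee_fin rs'.
have := dx s (le_trans t0t ts) sT; rewrite us.
move: tj; rewrite -ij ti => -[<-].
by rewrite /feedback /sampling_error addrC subrK.
Qed.

(** * The Lyapunov functional along a trajectory *)

Let W t := V t (hist tau x t).

Lemma W_ge t : t0 <= t -> (t%:E < T)%E -> alpha1 (enorm (x t)) <= W t.
Proof.
move=> t0t tT; have t_ge0 : 0 <= t := le_trans t0_ge0 t0t.
have := V_bounds t_ge0 (trajectory_hist_continuous t0t tT).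
rewrite hist_now => -[/andP[lo _] /andP[V2_ge0 _]].
by rewrite /W /V hist_now; lra.
Qed.

Lemma W_le t : t0 <= t -> (t%:E < T)%E ->
  W t <= alpha2 (enorm (x t)) + alpha3 (hnorm (hist tau x t)).
Proof.
move=> t0t tT; have t_ge0 : 0 <= t := le_trans t0_ge0 t0t.
have := V_bounds t_ge0 (trajectory_hist_continuous t0t tT).
rewrite hist_now => -[/andP[_ up] /andP[_ V2up]].
by rewrite /W /V hist_now lerD.
Qed.

(** Between events the error stays below the threshold, so that the part
    [sigma * alpha1] of the threshold is absorbed by the dissipation. *)
Lemma W_dini t : t0 <= t -> (t%:E < T)%E ->
  dini_le W t (- lam * W t + threshold t).
Proof.
move=> t0t tT; have t_ge0 : 0 <= t := le_trans t0_ge0 t0t.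
have [i [r [T' [ti t0r rt tnext held]]]] := held_until_next_event t0t tT.
have := V_dini t_ge0 (trajectory_hist_continuous t0t tT) held.
move=> /dini_dini_le dW q Wq; apply: dW; apply: le_lt_trans Wq.
have := below_threshold_before_next exp_ruleP trigger_continuous trigger_reset
  trajectory_continuous_from ti t0r rt tT tnext.
rewrite /trigger /sampling_error -/(W t); have := W_ge t0t tT.
rewrite /lam => h1 h2; have := ler_wpM2l sigma_ge0 h1; lra.
Qed.

(** The threshold decreases, so from [t1] on it can be replaced by its value at
    [t1]. *)
Lemma W_decay t1 e s : t0 <= t1 -> 0 <= s -> s < lam * e - threshold t1 ->
  forall t, t1 <= t -> (t%:E < T)%E ->
  W t <= Num.max e (W t1 - s * (t - t1)).
Proof.
move=> t01 s0 slt t t1t tT; have t0t := le_trans t01 t1t.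
apply: (@dini_decay _ W t1 t lam (threshold t1)) => //.
- have [u us _] := sampled_solution.
  apply: continuous_subspaceW (solution_V_continuous V1_V0 V2_V0star us t0_ge0 t0t tT).
  by move=> r /=; rewrite !in_itv /= => /andP[t1r ->]; rewrite (le_trans t01).
- move=> r /andP[t1r rt] q rq; apply: W_dini.
  + exact: le_trans t1r.
  + by apply: lt_trans tT; rewrite lte_fin.
  + by apply: le_lt_trans rq; rewrite lerD2l threshold_nonincreasing.
- by rewrite t1t lexx.
Qed.

(** [W] cannot exceed both its initial value and a level at which the dissipation
    beats the largest value of the threshold; [alpha1] is unbounded, so this
    bounds the state. *)
Lemma trajectory_bounded : exists2 r, 0 <= r &
  forall t, t0 - tau%:num <= t -> (t%:E < T)%E -> enorm (x t) <= r.
Proof.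
pose e := (threshold t0 + 1) / lam.
have lame : lam * e = threshold t0 + 1 by rewrite /e mulrC divfK ?gt_eqF.
have We t : t0 <= t -> (t%:E < T)%E -> W t <= Num.max e (W t0).
  move=> t0t tT; have := @W_decay t0 e 0 (lexx _) (lexx _) _ t t0t tT.
  by rewrite mul0r subr0; apply; rewrite lame; lra.
have [r r0 Mr] : exists2 r, 0 <= r & Num.max e (W t0) < alpha1 r.
  have [_ /cvgryPgt/(_ (Num.max e (W t0)))[A [_ AP]]] := alpha1_Kinf.
  exists (Num.max 0 (A + 1)); first by rewrite le_max lexx.
  by apply: AP; rewrite lt_max ltrDl ltr01 orbT.
have phi_ge0 := hnorm_ge0 phi_continuous.
exists (Num.max r (hnorm phi)); first by rewrite le_max r0.
move=> t taut tT; rewrite le_max; have [t0t|tt0] := leP t0 t.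
  apply/orP; left; apply: (classK_leP alpha1K r0); apply: ltW.
  by apply: le_lt_trans Mr; apply: le_trans (W_ge t0t tT) (We t t0t tT).
apply/orP; right; have [u us _] := sampled_solution.
have [|s xs _] := solution_initial us (s := t - t0); first by apply/andP; split; lra.
by rewrite -(subrKC t0 t) xs enorm_le_hnorm.
Qed.

(** On a bounded time interval the vector field is bounded along the
    trajectory, hence the trajectory is Lipschitz. *)
Lemma trajectory_lipschitz B : exists2 K, 0 < K &
  forall s t, t0 <= s -> s <= t -> (t%:E < T)%E -> t <= B ->
    enorm (x t - x s) <= K * (t - s).
Proof.
have [r r0 xr] := trajectory_bounded.
have [C kC] := feedback_bounded k_lip r.
have [K0 K00 fK] := vector_field_bound f0 f_lip2 f_lip3 (`|B| + r + `|C|).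
have hB := ler_norm B; have hC := ler_norm C.
have hB0 := normr_ge0 B; have hC0 := normr_ge0 C.
exists (K0 * (r + `|C|) + 1); first by rewrite ltr_wpDl // mulr_ge0 // addr_ge0.
move=> s t t0s st tT tB.
have [u [_ _ _ dx] uk] := sampled_control.
apply: (@right_derivative_lipschitz _ _ x (fun p => f p (hist tau x p) (u p)) t0 t) => //.
  exact: trajectory_continuous_from (le_trans t0s st) tT.
move=> p /andP[t0p pt].
have pT : (p%:E < T)%E by apply: lt_trans tT; rewrite lte_fin.
split; first exact: dx.
have hr : hnorm (hist tau x p) <= r.
  apply: hnorm_le => q; have /andP[q1 q2] := set_val_delay q.
  apply: xr; first by lra.
  by apply: le_lt_trans pT; rewrite lee_fin; lra.
have ur : enorm (u p) <= `|C|.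
  have [i [q [ti t0q qp _ ->]]] := uk p t0p pT.
  apply: le_trans hC; apply: kC; apply: xr.
    by apply: le_trans t0q; rewrite gerBl.
  by apply: le_lt_trans pT; rewrite lee_fin.
apply: (@le_lt_trans _ _ (K0 * (hnorm (hist tau x p) + enorm (u p)))).
  apply: fK; [|exact: trajectory_hist_continuous|lra|lra].
  apply/andP; split; first exact: le_trans t0p.
  by have := ltW pt; lra.
have : K0 * (hnorm (hist tau x p) + enorm (u p)) <= K0 * (r + `|C|).
  by rewrite ler_wpM2l // lerD.
lra.
Qed.

(** Between two events the state moves at least by [decay_radius], which is
    bounded below on bounded time intervals, and its speed is bounded there. *)
Lemma dwell_time B : exists2 d, 0 < d & forall i r s,
  te i = r%:E -> te i.+1 = s%:E -> s <= B -> r + d <= s.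
Proof.
have [K K0 xK] := trajectory_lipschitz B.
exists (decay_radius B / K); first by rewrite divr_gt0 // decay_radius_gt0.
move=> i r s ti ts sB.
have [|[r' ti' [t0r _]]] := closed_event_timeP i; first by rewrite ti.
move: ti'; rewrite ti => -[rr]; rewrite -rr in t0r => {r' rr}.
have [[s' [ts' rs sT rules _]]|[]] := closed_event_timeS ti t0r; last by rewrite ts.
move: ts'; rewrite ts => -[ss]; rewrite -ss in rs sT rules => {s' ss}.
have : decay_radius s <= enorm (x r - x s).
  apply: (classK_leP chiK (enorm_ge0 _)); rewrite rules lerDr mulr_ge0 //.
  by rewrite (classK_ge0 alpha1K) // enorm_ge0.
rewrite enormB; have := xK r s t0r (ltW rs) sT sB.
have := decay_radius_nonincreasing sB.
move=> h1 h2 h3; rewrite -lerBrDl ler_pdivrMr // mulrC.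
exact: le_trans h1 (le_trans h3 h2).
Qed.

Lemma event_times_unbounded B : exists N, (B%:E < te N)%E.
Proof.
have [d d0 dw] := dwell_time B.
apply: contrapT => none.
have teB i : (te i <= B%:E)%E by rewrite leNgt; apply/negP => h; apply: none; exists i.
have grow i : exists2 r, te i = r%:E & t0 + i%:R * d <= r.
  elim: i => [|i [r ti IH]]; first by exists t0; rewrite // mul0r addr0.
  have := teB i.+1; have [->|[s ts _]] := closed_event_timeP i.+1; first by rewrite leye_eq.
  rewrite ts lee_fin => sB; exists s => //.
  by have := dw _ _ _ ti ts sB; rewrite -natr1 mulrDl mul1r; lra.
have [N BN] : exists N : nat, B - t0 < N%:R * d.
  exists (Num.truncn (`|B - t0| / d)).+1.
  rewrite -ltr_pdivrMr //; apply: le_lt_trans (truncnS_gt _).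
  by rewrite ler_pM2r ?invr_gt0 // ler_norm.
have [r tN tr] := grow N; have := teB N; rewrite tN lee_fin => rB; lra.
Qed.

Lemma no_zeno : ~ zeno te.
Proof.
move=> [B]; apply; have [N BN] := event_times_unbounded B.
apply: sub_finite_set (finite_II N) => i /= iB; rewrite ltnNge; apply/negP.
by move=> /closed_event_time_homo /le_trans /(_ iB) /(lt_le_trans BN); rewrite ltxx.
Qed.

End Trajectory.

(** * Stability and attractivity *)

(** Stability over a finite time horizon, whatever the sampling: the control is
    [k] of a state that is at least as old, so an exponential that grows fast
    enough stays above the state (Gronwall). *)
Lemma finite_horizon_stability M rho : t0 <= M -> 0 < rho ->
  exists2 delta, 0 < delta & forall phi x, continuous phi -> hnorm phi < delta ->
    sol phi +oo%E x -> forall t, t0 - tau%:num <= t <= M -> enorm (x t) <= rho.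
Proof.
move=> t0M rho0.
have [dk dk0 [Lk Lk0 kL]] := feedback_small k_lip k0.
pose r := Num.min rho dk.
have r0 : 0 < r by rewrite lt_min rho0.
have r_rho : r <= rho by rewrite ge_min lexx.
have r_dk : r <= dk by rewrite ge_min lexx orbT.
have Lr0 : 0 <= Lk * r by rewrite mulr_ge0 // ltW.
have M0 : 0 <= M := le_trans t0_ge0 t0M.
have [K K0 fK] := vector_field_bound f0 f_lip2 f_lip3 (M + r + Lk * r).
(* below [z] the vector field is at most [K * (1 + Lk) * z]; one more makes the
   growth rate of [z] strictly larger *)
pose K1 := K * (1 + Lk) + 1.
have K10 : 0 < K1 by rewrite ltr_wpDl // mulr_ge0 // addr_ge0.
pose z t := r * expR (K1 * (t - M)).
have z0 t : 0 < z t by rewrite mulr_gt0 // expR_gt0.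
have z_mono s t : s <= t -> z s <= z t.
  by move=> st; rewrite /z ler_pM2l // ler_expR ler_pM2l // lerD2r.
have zr t : t <= M -> z t <= r.
  by move=> /z_mono /le_trans; apply; rewrite /z subrr mulr0 expR0 mulr1.
have zD t h : z t + K1 * z t * h <= z (t + h).
  have -> : z (t + h) = z t * expR (K1 * h).
    by rewrite /z -mulrA -expRD; congr (_ * expR _); ring.
  have -> : z t + K1 * z t * h = z t * (1 + K1 * h) by ring.
  by rewrite ler_pM2l // expR_ge1Dx.
have cz : continuous z.
  move=> t; apply: cvgM; first exact: cvg_cst.
  apply: (@continuous_comp _ _ _ (fun s => K1 * (s - M)) (@expR R)); last first.
    exact: continuous_expR.
  apply: cvgM; first exact: cvg_cst.
  by apply: cvgB; [exact: cvg_id | exact: cvg_cst].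
exists (z t0) => // phi x cphi phi_z x_sol.
have [u us uk] := sampled_control x_sol.
have past s : t0 - tau%:num <= s <= t0 -> enorm (x s) <= z t0.
  move=> /andP[s1 s2]; apply: ltW; apply: le_lt_trans phi_z.
  have [|q xs _] := solution_initial us (s := s - t0); first by apply/andP; split; lra.
  by rewrite -(subrKC t0 s) xs enorm_le_hnorm.
have below t : t0 <= t <= M -> enorm (x t) - z t <= 0.
  apply: (@barrier _ (fun t => enorm (x t) - z t)) => //.
  - move=> p; apply: cvgB; last exact: (continuous_subspaceT cz).
    apply: continuous_cvg; first exact: enorm_continuous.
    exact: (trajectory_continuous_from x_sol t0M (ltry M)).
  - by rewrite subr_le0; apply: past; rewrite lexx andbT gerBl.
  move=> {}t /andP[t0t tM] small /eqP; rewrite subr_eq0 => /eqP xz.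
  have xt s : t0 - tau%:num <= s -> s <= t -> enorm (x s) <= z t.
    move=> s1 st; have [t0s|st0] := leP t0 s.
      apply: le_trans (z_mono _ _ st); rewrite -subr_le0.
      by apply: small; rewrite t0s.
    by apply: le_trans (z_mono _ _ t0t); apply: past; rewrite s1 ltW.
  have zt := zr _ (ltW tM).
  have hz : hnorm (hist tau x t) <= z t.
    by apply: hnorm_le => q; have /andP[q1 q2] := set_val_delay q; apply: xt; lra.
  have uz : enorm (u t) <= Lk * z t.
    have [i [s [_ t0s st _ ->]]] := uk t t0t (ltry t).
    have xs : enorm (x s) <= z t by apply: xt => //; apply: le_trans t0s; rewrite gerBl.
    apply: le_trans (kL _ (le_trans xs (le_trans zt r_dk))) _.
    by rewrite ler_wpM2l.
  have Lz : Lk * z t <= Lk * r by rewrite ler_wpM2l.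
  have fz : enorm (f t (hist tau x t) (u t)) < K1 * z t.
    apply: (@le_lt_trans _ _ (K * (hnorm (hist tau x t) + enorm (u t)))).
      apply: fK; [|exact: (trajectory_hist_continuous x_sol t0t (ltry t))|lra|lra].
      apply/andP; split; first exact: le_trans t0t.
      by have := ltW tM; lra.
    have : K * (hnorm (hist tau x t) + enorm (u t)) <= K * (z t + Lk * z t).
      by rewrite ler_wpM2l // lerD.
    by rewrite /K1; have := z0 t; nra.
  case: us => _ _ _ /(_ t t0t (ltry t)) dx.
  have := right_derivative_bound dx fz; apply: filter_app; near=> h => xh.
  have := enorm_le_sub (x (t + h)) (x t); have := zD t h.
  by rewrite xz; lra.
move=> t /andP[t1 tM]; apply: le_trans r_rho; have [t0t|tt0] := leP t0 t.
  by apply: le_trans (zr _ tM); rewrite -subr_le0; apply: below; rewrite t0t.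
by apply: le_trans (zr _ t0M); apply: past; rewrite t1 ltW.
Unshelve. all: by end_near. Qed.

(** Up to a late time [M] the state stays small by stability on a finite
    horizon; from [M] on the threshold is so small that [W] cannot leave a small
    sublevel set. *)
Lemma closed_loop_stable : stable sol t0.
Proof.
move=> eps eps0.
have al0 : 0 < alpha1 eps by apply: (classK_gt0 alpha1K).
pose e := alpha1 eps / 2; have e0 : 0 < e by rewrite divr_gt0.
have e_al : e < alpha1 eps by rewrite /e; lra.
have [M t0M Mlam] := threshold_small (mulr_gt0 lam_gt0 e0).
have [r2 r20 al2] := classK_small alpha2_Kinf.1 (divr_gt0 e0 (ltr0n _ 2)).
have [r3 r30 al3] := classK_small alpha3_Kinf.1 (divr_gt0 e0 (ltr0n _ 2)).
pose rho := Num.min (eps / 2) (Num.min r2 r3).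
have rho0 : 0 < rho by rewrite !lt_min r20 r30 divr_gt0.
have rho_eps : rho <= eps / 2 by rewrite ge_min lexx.
have rho_r2 : rho <= r2 by rewrite !ge_min lexx orbT.
have rho_r3 : rho <= r3 by rewrite !ge_min lexx !orbT.
have [delta delta0 small] := finite_horizon_stability t0M rho0.
exists delta => // phi x cphi phid x_sol t t0t.
have xrho := small phi x cphi phid x_sol.
have tau_t0 : t0 - tau%:num <= t0 by rewrite gerBl.
have [tM|Mt] := leP t M.
  apply: le_lt_trans (xrho t _) _; last by lra.
  by rewrite tM andbT (le_trans tau_t0).
have W_M : V M (hist tau x M) <= e.
  apply: le_trans (W_le x_sol t0M (ltry M)) _.
  have h2 : alpha2 (enorm (x M)) <= alpha2 r2.
    apply: (classK_le alpha2_Kinf.1); first exact: enorm_ge0.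
    by apply: le_trans rho_r2; apply: xrho; rewrite lexx andbT (le_trans tau_t0).
  have h3 : alpha3 (hnorm (hist tau x M)) <= alpha3 r3.
    apply: (classK_le alpha3_Kinf.1).
      by apply: hnorm_ge0; exact: (trajectory_hist_continuous x_sol t0M (ltry M)).
    apply: le_trans rho_r3; apply: hnorm_le => q; apply: xrho.
    by have /andP[q1 q2] := set_val_delay q; apply/andP; split; lra.
  lra.
apply: (classK_ltP alpha1K (ltW eps0)); apply: le_lt_trans e_al.
apply: le_trans (W_ge x_sol t0t (ltry t)) _.
have slt : 0 < lam * e - threshold M by rewrite subr_gt0.
have := W_decay x_sol t0M (lexx 0) slt (ltW Mt) (ltry t).
by rewrite mul0r subr0 (max_idPl W_M).
Qed.

(** Once the threshold is below [lam * e], the decay of [W] brings it under [e]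
    after a time proportional to its value. *)
Lemma closed_loop_attractive : globally_attractive sol.
Proof.
move=> phi x cphi x_sol; apply/cvgrPdist_lt => eps eps0.
have al0 : 0 < alpha1 eps by apply: (classK_gt0 alpha1K).
pose e := alpha1 eps / 2; have e0 : 0 < e by rewrite divr_gt0.
have e_al : e < alpha1 eps by rewrite /e; lra.
have [M t0M Mlam] := threshold_small (mulr_gt0 lam_gt0 e0).
pose s := (lam * e - threshold M) / 2.
have s0 : 0 < s by rewrite divr_gt0 // subr_gt0.
have slt : s < lam * e - threshold M by rewrite /s; lra.
pose W_M := V M (hist tau x M).
near=> t.
have Mt : M <= t by near: t; apply: nbhs_pinfty_ge; exact: num_real.
have t0t := le_trans t0M Mt.
have tlarge : W_M / s + M <= t by near: t; apply: nbhs_pinfty_ge; exact: num_real.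
rewrite sub0r normrN ger0_norm ?enorm_ge0 //.
apply: (classK_ltP alpha1K (ltW eps0)); apply: le_lt_trans e_al.
apply: le_trans (W_ge x_sol t0t (ltry t)) _.
apply: le_trans (W_decay x_sol t0M (ltW s0) slt Mt (ltry t)) _.
rewrite ge_max lexx /= -/W_M; apply: le_trans (ltW e0).
by rewrite subr_le0 mulrC -ler_pdivrMr // lerBrDr.
Unshelve. all: by end_near. Qed.


(** * Forward completeness *)

(** The event times exceed [Tr] after finitely many steps, and an event time that
    does not precede the end [Tr] is infinite. *)
Lemma last_event_before_finite_end (phi : history tau n) Tr x :
  continuous phi -> sol phi Tr%:E x ->
  exists j r, [/\ event_time rule t0 Tr%:E x j = r%:E, t0 <= r, r < Tr,
    event_time rule t0 Tr%:E x j.+1 = +oo%E &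
    forall t, r <= t -> t < Tr -> ~ rule t (x r - x t) (x t)].
Proof.
move=> cphi x_sol; set te := event_time rule t0 Tr%:E x.
have ex_infinite : exists i, te i == +oo%E.
  have [N TN] := event_times_unbounded cphi x_sol Tr; exists N.
  have [tN|[r tN [_ rT]]] := closed_event_timeP x_sol N; first by rewrite /te tN.
  by rewrite /te tN in TN; have := lt_trans TN rT; rewrite ltxx.
case: (ex_minnP ex_infinite) => -[//|j] /eqP tj1 jmin.
have [tj|[r tj [t0r]]] := closed_event_timeP x_sol j.
  by have := jmin j; rewrite /te tj eqxx ltnn => /(_ isT).
rewrite lte_fin => rT; exists j, r; split=> //.
have [[s [ts _ _ _ _]]|[_ norule]] := closed_event_timeS x_sol tj t0r.
  by rewrite /te ts in tj1.
by move=> t rt tT; apply: norule => //; rewrite lte_fin.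
Qed.

(** A trajectory on a bounded interval has a limit at the right end, by the
    Lipschitz estimate. The system restarts from there with the control held,
    after a new sample if the triggering equation holds at the limit, and there
    is no event for a while since the triggering function is then negative. *)
Lemma closed_loop_extension (phi : history tau n) Tr x :
  continuous phi -> sol phi Tr%:E x ->
  exists T' z, [/\ Tr < T', sol phi T'%:E z & forall t, t < Tr -> z t = x t].
Proof.
move=> cphi x_sol.
have t0Tr : t0 < Tr by have := start_lt x_sol; rewrite lte_fin.
have Tr_ge0 : 0 <= Tr by apply: le_trans t0_ge0 (ltW t0Tr).
have tau_Tr : Tr - tau%:num < Tr by rewrite gtrBl.
have tau_t0 : t0 - tau%:num <= t0 by rewrite gerBl.
have [j [r [tj t0r rTr tj1 norule]]] := last_event_before_finite_end cphi x_sol.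
have [K K0 xK] := trajectory_lipschitz cphi x_sol Tr.
have [l xl] : exists l : 'rV[R]_n, x t @[t --> Tr^'-] --> l.
  apply: (lipschitz_left_limit t0Tr K0) => s t t0s st tTr.
  by apply: xK => //; rewrite ?lte_fin // ltW.
pose xe t := if t < Tr then x t else l.
have xeE t : t < Tr -> xe t = x t by rewrite /xe => ->.
have xeTr : xe Tr = l by rewrite /xe ltxx.
have cxe : {within `[t0 - tau%:num, Tr], continuous xe}.
  have [u [_ cx _ _] _] := sampled_solution x_sol.
  exact: left_limit_continuous cx xl.
have cpsi : continuous (hist tau xe Tr).
  apply: hist_continuous; apply: continuous_subspaceW cxe => s /=.
  by rewrite !in_itv /= => /andP[s1 ->]; rewrite andbT; lra.
have [v [v_neg v_cases]] : exists v, trigger Tr (v - l) l < 0 /\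
    ((rule Tr (x r - l) l /\ v = l) \/ (~ rule Tr (x r - l) l /\ v = x r)).
  have [ruleTr|noruleTr] := pselect (rule Tr (x r - l) l).
    by exists l; rewrite subrr; split; [exact: trigger_reset | left].
  exists (x r); split; last by right.
  have cxer : {within `[r, Tr], continuous xe}.
    apply: continuous_subspaceW cxe => s /=; rewrite !in_itv /= => /andP[rs ->].
    by rewrite andbT; lra.
  have := below_threshold exp_ruleP trigger_continuous (v := x r) (ltW rTr) cxer.
  rewrite xeTr xeE // subrr; apply; first exact: trigger_reset.
  move=> s /andP[rs]; rewrite le_eqVlt => /predU1P[->|sTr]; first by rewrite xeTr.
  by rewrite xeE //; exact: norule.
have [T2 [y y_sol]] := f_solvable v Tr_ge0 cpsi.
have yE s : Tr - tau%:num <= s <= Tr -> y s = xe s.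
  move=> /andP[s1 s2].
  have [|q ys qE] := solution_initial y_sol (s := s - Tr); first by apply/andP; split; lra.
  by rewrite -(subrKC Tr s) ys /hist qE.
have yTr : y Tr = l by rewrite yE ?xeTr // lexx andbT ltW.
have [S2 TrS2 S2T2] : exists2 S2, Tr < S2 & (S2%:E < T2)%E.
  case: y_sol => + _ _ _; case: T2 => [T2|_|//]; last by exists (Tr + 1); rewrite ?ltry ?ltrDl.
  by rewrite lte_fin => TrT2; exists ((Tr + T2) / 2); rewrite ?lte_fin; lra.
have [d d0 d_neg] : exists2 d, 0 < d &
    forall t, Tr <= t <= S2 -> t < Tr + d -> trigger t (v - y t) (y t) < 0.
  have cy : {within `[Tr, S2], continuous y}.
    apply: continuous_subspaceW (solution_continuous y_sol (ltW TrS2) S2T2) => s /=.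
    by rewrite !in_itv /= => /andP[s1 ->]; rewrite andbT; lra.
  pose Y := y \o clamp Tr S2.
  have cY : continuous Y := within_clamp_continuous (ltW TrS2) (@subset_refl _ _) cy.
  have YE s : Tr <= s <= S2 -> Y s = y s by move=> sS; rewrite /Y /= clamp_id.
  have YTr : Y Tr = l by rewrite YE // lexx ltW.
  have neg0 : 0 < - trigger Tr (v - l) l by rewrite oppr_gt0.
  have [d d0 dP] := continuous_epsdelta Tr (trigger_continuous (v := v) cY) neg0.
  exists d => // t tS td; have /andP[Trt _] := tS.
  have tTrd : `|t - Tr| < d by rewrite ger0_norm ?subr_ge0 // ltrBlDl.
  have := dP t tTrd; rewrite (YE t) // YTr => /ltr_normlW.
  by rewrite ltrBlDl subrr.
pose T' := Num.min S2 (Tr + d).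
have TrT' : Tr < T' by rewrite lt_min TrS2 ltrDl.
have T'S2 : T' <= S2 by rewrite ge_min lexx.
have T'd : T' <= Tr + d by rewrite ge_min lexx orbT.
have norule_y t : Tr <= t -> t < T' -> ~ rule t (v - y t) (y t).
  move=> Trt tT' /exp_ruleP/eqP; apply/negP; rewrite lt_eqF //; apply: d_neg.
    by rewrite Trt ltW // (lt_le_trans tT').
  exact: lt_le_trans T'd.
pose z t := if t < Tr then x t else y t.
have zx t : t < Tr -> z t = x t by rewrite /z => ->.
have zy t : Tr <= t -> z t = y t by rewrite /z ltNge => ->.
exists T', z; split=> //.
case: (x_sol) => eps cover eps_sol.
pose eps' t := if t < Tr then eps t else v - y t.
set te := event_time rule t0 Tr%:E x in cover.
pose te' := event_time rule t0 T'%:E z.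
have te'E i s : te i = s%:E -> te' i = s%:E.
  apply: (event_time_extension exp_ruleP trigger_continuous trigger_reset).
  - exact: start_lt x_sol.
  - exact: trajectory_continuous_from x_sol.
  - by rewrite lee_fin ltW.
  - by move=> t _; rewrite lte_fin; exact: zx.
have tj' := te'E _ _ tj.
(* [J] is the last event of the continuation: [j] itself, or [j.+1] if the
   triggering equation holds at [Tr] *)
have [J [rJ [tJ rJTr zv tJ1 next_late]]] : exists J rJ, [/\ te' J = rJ%:E, rJ <= Tr,
    z rJ = v, te' J.+1 = +oo%E & (Tr%:E <= te' j.+1)%E].
  case: v_cases => [[ruleTr vl]|[noruleTr vx]].
    have tj1' : te' j.+1 = Tr%:E.
      apply: (event_time_next tj'); rewrite ?lte_fin ?(ltW rTr) //.
        by rewrite zx // zy // yTr.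
      move=> t rt tT'; rewrite leNgt => rulet; apply/negP => tTr.
      by move: rulet; rewrite !zx //; exact: norule.
    exists j.+1, Tr; split=> //; last by rewrite tj1'.
      by rewrite zy // yTr.
    apply: (event_time_last tj1') => t Trt; rewrite lte_fin => tT'.
    by rewrite !zy // yTr -vl; exact: norule_y.
  have tj1' : te' j.+1 = +oo%E.
    apply: (event_time_last tj') => t rt; rewrite lte_fin => tT'.
    rewrite (zx r) //; have [tTr|Trt] := ltP t Tr; first by rewrite zx //; exact: norule.
    by rewrite zy // -vx; exact: norule_y.
  by exists j, r; split=> //; rewrite ?tj1' ?leey ?zx // ltW.
exists eps'.
  move=> t t0t; rewrite lte_fin => tT'; have [tTr|Trt] := ltP t Tr; last first.
    exists J; rewrite -/te' tJ ?tJ1 ?ltry ?lee_fin ?(le_trans rJTr) //=.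
    by rewrite /eps' ltNge Trt /= /sampling_error zv zy.
  have tTrE : (t%:E < Tr%:E)%E by rewrite lte_fin.
  have [i /andP[i1 i2] epsE] := cover t t0t tTrE.
  have [ri ti [t0ri riT rit]] := event_time_le_fin exp_ruleP trigger_continuous
    trigger_reset (start_lt x_sol) (trajectory_continuous_from x_sol) i1.
  exists i; rewrite -/te' (te'E _ _ ti); last first.
    rewrite /eps' tTr epsE /te ti /sampling_error /= !zx //.
  rewrite lee_fin rit /=.
  have [ti1|[s ti1 _]] := closed_event_timeP x_sol i.+1; last first.
    by rewrite (te'E _ _ ti1); move: i2; rewrite /te ti1.
  have ij : i = j.
    case: (ltngtP i j) => // /(closed_event_time_homo x_sol).
      by rewrite ti1 tj.
    by rewrite tj1 ti.
  by rewrite ij (lt_le_trans tTrE).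
have -> : feedback k eps' z = fun t => if t < Tr then feedback k eps x t
    else feedback k (sampling_error v y) y t.
  by apply/funext => t; rewrite /feedback /eps' /z /sampling_error; case: ltP.
apply: (solution_glue eps_sol y_sol) => //.
  by move=> s /andP[s1 s2]; rewrite yE ?xeE // s1 ltW.
by apply: ltW; apply: le_lt_trans S2T2; rewrite lee_fin.
Qed.

Lemma closed_loop_complete : forward_complete sol t0.
Proof.
move=> phi [Tr| |] x cphi [x_sol x_max] //; last first.
  by have := start_lt x_sol.
have [T' [z [TrT' z_sol zx]]] := closed_loop_extension cphi x_sol.
have [] : T'%:E = Tr%:E.
  apply: x_max z_sol _ _; first by rewrite lee_fin ltW.
  by move=> t _; rewrite lte_fin; exact: zx.
by move=> TT; rewrite TT ltxx in TrT'.
Qed.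

End ClosedLoop.

Theorem theorem2 (R : realType) (tau : {posnum R}) (n m : nat)
    (f : R -> history tau n -> 'rV[R]_m -> 'rV[R]_n)
    (k : 'rV[R]_n -> 'rV[R]_m) (t0 : R)
    (V1 : R -> 'rV[R]_n -> R) (V2 : R -> history tau n -> R)
    (alpha1 alpha2 alpha3 chi : R -> R) (mu sigma a b : R)
    (V := fun (t : R) (phi : history tau n) => V1 t (phi (now tau)) + V2 t phi)
    (rule := @exp_rule R n chi alpha1 sigma a b t0)
    (sol := closed_loop_solution f k rule t0) :
  0 <= t0 ->
  (forall t : R, 0 <= t -> f t (fun=> 0) 0 = 0) ->
  k 0 = 0 ->
  locally_solvable f k ->
  classV0 V1 -> classV0star V2 ->
  classKinf alpha1 -> classKinf alpha2 -> classKinf alpha3 -> classK chi ->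
  0 < mu ->
  (* (i) *)
  (forall (t : R) (phi : history tau n), 0 <= t -> continuous phi ->
     (alpha1 (enorm (phi (now tau))) <= V1 t (phi (now tau))
        <= alpha2 (enorm (phi (now tau)))) /\
     (0 <= V2 t phi <= alpha3 (hnorm phi))) ->
  (* (ii) *)
  (forall (t : R) (phi : history tau n), 0 <= t -> continuous phi ->
     forall (v : 'rV[R]_n) T x, held_solution f k v t phi T x ->
       (dini V t x <=
          (- mu * V t phi + chi (enorm (sampling_error v x t)))%:E)%E) ->
  0 <= sigma < mu -> 0 < a -> 0 < b ->
  (* (iii) *)
  [locally [lipschitz chi s | s in `[0, +oo[]] ->
  [locally [lipschitz k y | y in setT]] ->
  (forall c d : R, 0 < c -> c <= d ->
     [lipschitz 'pinv_(fun=> 0) `[0, +oo[ alpha1 s | s in `[c, d]]) ->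
  (* (iv) *)
  locally_lipschitz2 f -> locally_lipschitz3 f ->
  globally_asymptotically_stable sol t0 /\
  (forall (phi : history tau n) T x, continuous phi -> sol phi T x ->
     ~ zeno (event_time rule t0 T x)).
Proof.
move=> t0_ge0 f0 k0 f_solvable V1_V0 V2_V0star alpha1_Kinf alpha2_Kinf alpha3_Kinf.
move=> chiK mu_gt0 V_bounds V_dini sigma_mu a_gt0 b_gt0 _ k_lip _ f_lip2 f_lip3.
split; last first.
  move=> phi T x phi_continuous x_sol.
  exact: (no_zeno t0_ge0 f0 V1_V0 V2_V0star alpha1_Kinf chiK V_bounds V_dini
    sigma_mu a_gt0 b_gt0 k_lip f_lip2 f_lip3 phi_continuous x_sol).
split.
- exact: (closed_loop_complete t0_ge0 f0 f_solvable V1_V0 V2_V0star alpha1_Kinf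
    chiK V_bounds V_dini sigma_mu a_gt0 b_gt0 k_lip f_lip2 f_lip3).
- exact: (closed_loop_stable t0_ge0 f0 k0 V1_V0 V2_V0star alpha1_Kinf alpha2_Kinf
    alpha3_Kinf chiK V_bounds V_dini sigma_mu a_gt0 b_gt0 k_lip f_lip2 f_lip3).
- exact: (closed_loop_attractive t0_ge0 V1_V0 V2_V0star alpha1_Kinf
    chiK V_bounds V_dini sigma_mu a_gt0 b_gt0).
Qed.
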